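(* Let Alice and Bob hold finite-dimensional quantum systems with Hamiltonians $H^{(A)},H^{(B)}$ and local inverse temperatures $\beta^{(A)},\beta^{(B)}$. For every $n\ge1$, the set $\mathrm{LTOCC}_n+\mathrm{R}$ ($n$-round Local Thermal Operations and Classical Communication without memory, with projective energy-incoherent measurements and with shared randomness) is a subset of the set of semilocal thermal operations with respect to $(\beta^{(A)},\beta^{(B)})$. This holds for the operations as quantum channels, i.e. even for states that are not energy-incoherent.
   Context: Local thermal operation on a system with Hamiltonian $H$ and inverse temperature $\beta$: a channel $\Lambda(\rho)=\mathrm{Tr}_E[U(\rho\otimes\gamma_E)U^\dagger]$ with $E$ a bath with Hamiltonian $H_E$, $\gamma_E=e^{-\beta H_E}/\mathrm{Tr}(e^{-\beta H_E})$, $U$ unitary and $[U,H\otimes\mathbb 1+\mathbb 1\otimes H_E]=0$. Projective energy-incoherent measurement: a family $\{P_k\}$ of mutually orthogonal projectors summing to the identity, each commuting with the local Hamiltonian. $\mathrm{LTOCC}_1$: channels of the form $\rho^{(AB)}\mapsto\sum_k(\Lambda^{(A)}\otimes\Lambda^{(B)}_k)\big((P^{(A)}_k\otimes\mathbb 1)\rho^{(AB)}(P^{(A)}_k\otimes\mathbb 1)\big)$, with $\{P_k^{(A)}\}$ a projective energy-incoherent measurement of Alice, $\Lambda_k^{(B)}$ local thermal operations of Bob conditioned on the outcome, $\Lambda^{(A)}$ a local thermal operation of Alice; or the same with the roles of Alice and Bob exchanged. $\mathrm{LTOCC}_n$: compositions of $n$ channels from $\mathrm{LTOCC}_1$ (measurement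 outcomes are erased after each round). $\mathrm{LTOCC}_n+\mathrm{R}$: convex combinations of channels in $\mathrm{LTOCC}_n$. Semilocal thermal operation (SLTO) with respect to $(\beta^{(A)},\beta^{(B)})$: a map $\Lambda^{(AB)}$ for which there exist local thermal baths $\mathcal B^{(A)},\mathcal B^{(B)}$ with Hamiltonians $H^{\mathcal B^{(A)}},H^{\mathcal B^{(B)}}$ and a unitary $U$ on baths and system with $$\Lambda^{(AB)}(\rho)=\mathrm{Tr}_{\mathcal B^{(A)},\mathcal B^{(B)}}\big[U(\gamma^{\mathcal B^{(A)}}\otimes\gamma^{\mathcal B^{(B)}}\otimes\rho)U^\dagger\big],$$ where $\gamma^{\mathcal B^{(X)}}=e^{-\beta^{(X)}H^{\mathcal B^{(X)}}}/\mathrm{Tr}(e^{-\beta^{(X)}H^{\mathcal B^{(X)}}})$, and $$[U,H^{(A)}+H^{(B)}+H^{\mathcal B^{(A)}}+H^{\mathcal B^{(B)}}]=0,\qquad [U,\beta^{(A)}(H^{(A)}+H^{\mathcal B^{(A)}})+\beta^{(B)}(H^{(B)}+H^{\mathcal B^{(B)}})]=0.$$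
   Formalization: The formal theorem assumes that the inverse temperatures of Alice and Bob are not both zero; when both vanish all bath states are maximally mixed and a mixture of local unitaries with irrational weights is not semilocal thermal, so the claim fails there. *)

(* Defs.v *)
From mathcomp Require Import all_boot all_order all_algebra.
From mathcomp Require Import all_classical all_reals all_analysis.
From mathcomp Require Import complex mxtens.

Set Implicit Arguments.
Unset Strict Implicit.
Unset Printing Implicit Defensive.

Import Order.TTheory GRing.Theory Num.Theory numFieldNormedType.Exports.

Local Open Scope classical_set_scope.
Local Open Scope ring_scope.
Local Open Scope sesquilinear_scope.

Section MatrixExponential.
Variable K : numFieldType.

(* The limit is taken in the topology of 'M[K]_n induced by the norm of K. *)
Definition expmx n (A : 'M[K]_n) : 'M[K]_n :=
  limn (series (fun k : nat => (k`!)%:R^-1 *: A ^+ k)).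

End MatrixExponential.

Section PartialTraces.
Variable K : pzRingType.

(* In a tensor product indexed by 'I_(m * n), the basis vector e_i (x) e_k has
   index mxtens_index (i, k), as in the Kronecker product *t. *)

Definition ptrace1 m n (X : 'M[K]_(m * n)) : 'M[K]_n :=
  \matrix_(i, j) \sum_(k < m) X (mxtens_index (k, i)) (mxtens_index (k, j)).

Definition ptrace2 m n (X : 'M[K]_(m * n)) : 'M[K]_m :=
  \matrix_(i, j) \sum_(k < n) X (mxtens_index (i, k)) (mxtens_index (j, k)).

(* The Hamiltonian A (x) 1 + 1 (x) B of a noninteracting composite system. *)
Definition addtens m n (A : 'M[K]_m) (B : 'M[K]_n) : 'M[K]_(m * n) :=
  A *t 1%:M + 1%:M *t B.

End PartialTraces.

Section ThermalOperations.
Variable R : realType.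
Local Notation C := R[i].

(* Channels are represented by their action on all of 'M[C]_d. *)
Definition channel d := 'M[C]_d -> 'M[C]_d.

(* For linear L and M, this is the linear map sending X (x) Y to
   L X (x) M Y, computed on the basis of matrix units. *)
Definition tens_channel m n (L : channel m) (M : channel n) : channel (m * n) :=
  fun X => \sum_(i < m) \sum_(j < m) \sum_(k < n) \sum_(l < n)
    X (mxtens_index (i, k)) (mxtens_index (j, l)) *:
      (L (delta_mx i j) *t M (delta_mx k l)).

Definition gibbs d (beta : R) (H : 'M[C]_d) : 'M[C]_d :=
  let w := expmx (- (beta%:C%C *: H)) in (\tr w)^-1 *: w.

(* Baths have an arbitrary nonzero finite dimension, here and in SLTO. *)
Definition LTO d (beta : R) (H : 'M[C]_d) : set (channel d) :=
  [set L | exists (e : nat) (HE : 'M[C]_e) (U : 'M[C]_(d * e)),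
    [/\ (0 < e)%N, HE \is hermsymmx, U \is unitarymx,
        comm_mx U (addtens H HE)
      & forall rho, L rho = ptrace2 (U *m (rho *t gibbs beta HE) *m U ^t* )]].

Definition energy_incoherent_measurement d (H : 'M[C]_d)
    (m : nat) (P : 'I_m -> 'M[C]_d) : Prop :=
  [/\ forall k, P k \is hermsymmx /\ P k *m P k = P k,
      forall k l, k != l -> P k *m P l = 0,
      \sum_k P k = 1%:M
    & forall k, comm_mx (P k) H].

Section Bipartite.
Variables (dA dB : nat) (betaA betaB : R) (HA : 'M[C]_dA) (HB : 'M[C]_dB).

Definition LTOCC1_from_Alice : set (channel (dA * dB)) :=
  [set L | exists (m : nat) (P : 'I_m -> 'M[C]_dA)
      (LA : channel dA) (LB : 'I_m -> channel dB),
    [/\ energy_incoherent_measurement HA P,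
        LTO betaA HA LA,
        forall k, LTO betaB HB (LB k)
      & forall rho, L rho = \sum_k tens_channel LA (LB k)
          ((P k *t 1%:M) *m rho *m (P k *t 1%:M))]].

Definition LTOCC1_from_Bob : set (channel (dA * dB)) :=
  [set L | exists (m : nat) (P : 'I_m -> 'M[C]_dB)
      (LA : 'I_m -> channel dA) (LB : channel dB),
    [/\ energy_incoherent_measurement HB P,
        forall k, LTO betaA HA (LA k),
        LTO betaB HB LB
      & forall rho, L rho = \sum_k tens_channel (LA k) LB
          ((1%:M *t P k) *m rho *m (1%:M *t P k))]].

Definition LTOCC1 : set (channel (dA * dB)) :=
  LTOCC1_from_Alice `|` LTOCC1_from_Bob.

Fixpoint LTOCC (n : nat) : set (channel (dA * dB)) :=
  if n is n'.+1 then
    [set L | exists L1 L2,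
      [/\ LTOCC1 L1, LTOCC n' L2 & forall rho, L rho = L1 (L2 rho)]]
  else [set L | forall rho, L rho = rho].

(* The weights p model the shared randomness. *)
Definition LTOCC_R (n : nat) : set (channel (dA * dB)) :=
  [set L | exists (m : nat) (p : 'I_m -> R)
      (Ls : 'I_m -> channel (dA * dB)),
    [/\ forall i, 0 <= p i, \sum_i p i = 1,
        forall i, LTOCC n (Ls i)
      & forall rho, L rho = \sum_i (p i)%:C%C *: Ls i rho]].

(* Tensor factors are ordered as (bath A (x) bath B) (x) (A (x) B). *)
Definition SLTO : set (channel (dA * dB)) :=
  [set L | exists (eA eB : nat) (KA : 'M[C]_eA) (KB : 'M[C]_eB)
      (U : 'M[C]_((eA * eB) * (dA * dB))),
    [/\ [/\ (0 < eA)%N, (0 < eB)%N, KA \is hermsymmx & KB \is hermsymmx],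
        U \is unitarymx,
        comm_mx U (addtens (addtens KA KB) (addtens HA HB)),
        comm_mx U (addtens
          (addtens (betaA%:C%C *: KA) (betaB%:C%C *: KB))
          (addtens (betaA%:C%C *: HA) (betaB%:C%C *: HB)))
      & forall rho, L rho = ptrace1
          (U *m ((gibbs betaA KA *t gibbs betaB KB) *t rho) *m U ^t* )]].

End Bipartite.
End ThermalOperations.

(* Main.v *)
Require Import Defs.
From mathcomp Require Import all_boot all_order all_algebra.
From mathcomp Require Import all_classical all_reals all_analysis.
From mathcomp Require Import complex mxtens.
From mathcomp Require Import ring.

(* Diagonalising the bath Hamiltonian turns a dilation into a family of blocks
   [W f e] indexed by pairs of bath levels: unitarity becomes
   [\sum_f (W f e)^* W f e' = delta_(e,e')], energy conservation says that
   [W f e] shifts the system energy by [h f - h e], and the channel is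
   [\sum_f \sum_e g e *: W f e rho (W f e)^*] with Gibbs weights [g].  In this
   form semilocal operations compose (by tensoring the baths), and they are
   convex when some beta is nonzero, since a bath with levels [- ln p / beta]
   has Gibbs weights [p].  A projective measurement with conditional action is
   done one outcome [P] at a time, by the blocks [P W f e +/- (1 - P)]
   averaged over a random sign, which is a degenerate two-level bath. *)

Set Implicit Arguments.
Unset Strict Implicit.
Unset Printing Implicit Defensive.

Import Order.TTheory GRing.Theory Num.Theory numFieldNormedType.Exports.

Local Open Scope classical_set_scope.
Local Open Scope ring_scope.
Local Open Scope sesquilinear_scope.

(** The measurement is the main obstacle. A single unitary controlled by the outcome, with blocks
    [\sum_k P k *m W k f e], would leave coherences between different outcomes. Treating one [P]
    against [1 - P] needs only a fair coin, available at every temperature, and the conditional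
    channels never have to share a bath. Successive steps do not disturb each other because the
    conditional operation acts on the other party's factor, so its blocks commute with the
    projectors. The measuring party's own operation does not depend on the outcome, so it factors
    out and is composed afterwards. Shared randomness needs arbitrary real weights, hence a bath
    with nondegenerate levels at a nonzero inverse temperature: at [beta = 0] all levels of a bath
    are equally likely. This register sits in the bath of one party, but a semilocal unitary may let
    it control both systems. Since the register never changes level, its energies cancel from both
    conservation laws. *)

(** * Gibbs states *)

Section Exponential.

(** A basic neighbourhood of a matrix constrains its entries separately, and finitely many eventual
    conditions hold eventually together. *)
Lemma cvg_mx (K : numFieldType) m n (X : nat -> 'M[K]_(m, n)) (L : 'M[K]_(m, n)) :
  (forall i j, X k i j @[k --> \oo] --> L i j) -> X @ \oo --> L.
Proof.
move=> XL A [P LP PA].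
have : \forall k \near \oo, forall ij : 'I_m * 'I_n, P ij.1 ij.2 (X k ij.1 ij.2).
  apply: filter_forall => -[i j]; exact: (XL i j _ (LP i j)).
by apply: filterS => k Xk; apply: PA => i j; exact: (Xk (i, j)).
Qed.

Lemma conj_diag_exp (K : numFieldType) n (V W : 'M[K]_n) (d : 'rV[K]_n) k :
  V *m W = 1%:M -> W *m V = 1%:M ->
  (W *m diag_mx d *m V) ^+ k = W *m diag_mx (\row_i d 0 i ^+ k) *m V.
Proof.
move=> VW WV; elim: k => [|k IHk].
  rewrite expr0; have -> : \row_i d 0 i ^+ 0 = const_mx 1.
    by apply/rowP => i; rewrite !mxE.
  by rewrite diag_const_mx mulmx1 WV.
rewrite exprSr IHk -[(_ * _)%R]/(_ *m _) !mulmxA -[W *m _ *m V *m W]mulmxA VW mulmx1.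
congr (_ *m V); rewrite -mulmxA mulmx_diag; congr (_ *m diag_mx _).
by apply/rowP => i; rewrite !mxE exprSr.
Qed.

Lemma expmx_conj_diag (K : numFieldType) n (V W : 'M[K]_n) (d e : 'rV[K]_n) :
  V *m W = 1%:M -> W *m V = 1%:M ->
  (forall i, series (fun k => (k`!)%:R^-1 * d 0 i ^+ k) @ \oo --> e 0 i) ->
  expmx (W *m diag_mx d *m V) = W *m diag_mx e *m V.
Proof.
move=> VW WV de; apply: cvg_lim; first exact: norm_hausdorff.
apply: cvg_mx => i j.
have diagE (x : 'rV[K]_n) :
    (W *m diag_mx x *m V) i j = \sum_l W i l * V l j * x 0 l.
  rewrite mul_mx_diag !mxE; apply: eq_bigr => l _.
  by rewrite !mxE mulrAC.
(* Each entry of the partial sums is a fixed linear combination of scalar partial sums, so only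
   scalar convergence is at stake. *)
rewrite diagE (_ : (fun k => _) = fun k =>
  \sum_l W i l * V l j * series (fun k => (k`!)%:R^-1 * d 0 l ^+ k) k); last first.
  apply/funext => k; rewrite /series /= summxE.
  have termE q : (q`!%:R^-1 *: (W *m diag_mx d *m V) ^+ q) i j =
      \sum_l W i l * V l j * (q`!%:R^-1 * d 0 l ^+ q).
    rewrite conj_diag_exp// [LHS]mxE diagE mulr_sumr.
    by apply: eq_bigr => l _; rewrite mxE mulrCA.
  rewrite (eq_bigr _ (fun q _ => termE q)).
  by rewrite exchange_big/=; apply: eq_bigr => l _; rewrite mulr_sumr.
apply: cvg_big => [|l _]; first exact: add_continuous.
exact: cvgMr (de l).
Qed.

Lemma cvg_real_complex (R : realType) (u : nat -> R) (l : R) :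
  u @ \oo --> l ->
  (fun k => (u k)%:C%C : (R[i] : numFieldType)) @ \oo --> (l%:C%C : (R[i] : numFieldType)).
Proof.
move=> /cvgrPdist_lt ul; apply/cvgrPdist_lt => e e0.
(* A positive element of [R[i]] is real, so the complex tolerance is a real one. *)
have eE : e = (complex.Re e)%:C%C by rewrite RRe_real// ger0_real// ltW.
have e0' : 0 < complex.Re e by move: e0; rewrite eE ltcR.
apply: filterS (ul _ e0') => k; rewrite eE -ltcR => /le_lt_trans; apply.
rewrite -rmorphB/= normc_def/= expr0n/= addr0 sqrtr_sqr.
exact: lexx.
Qed.

Lemma cvg_expC (R : realType) (x : R) :
  series (fun k => (k`!)%:R^-1 * (x%:C%C : (R[i] : numFieldType)) ^+ k) @ \oo -->
    ((expR x)%:C%C : (R[i] : numFieldType)).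
Proof.
have := cvg_real_complex (is_cvg_series_exp_coeff x).
rewrite (_ : (fun k => _) =
  series (fun k => (k`!)%:R^-1 * (x%:C%C : (R[i] : numFieldType)) ^+ k)) //.
apply/funext => k; rewrite /series/= rmorph_sum/=; apply: eq_bigr => q _.
by rewrite /exp_coeff /= rmorphM rmorphXn fmorphV rmorph_nat mulrC.
Qed.

End Exponential.

Section Gibbs.
Variable R : realType.
Local Notation C := R[i].

(** Levels are indexed by any finite type, so that joint baths are indexed by pairs and trivial
    baths by [unit]. *)
Definition gibbs_weight (E : finType) (beta : R) (h : E -> R) (e : E) : R :=
  expR (- beta * h e) / \sum_f expR (- beta * h f).

Definition diagC n (h : 'I_n -> R) : 'M[C]_n := diag_mx (\row_i (h i)%:C%C).

Lemma expmx_conj_diagC n (V W : 'M[C]_n) (h : 'I_n -> R) :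
  V *m W = 1%:M -> W *m V = 1%:M ->
  expmx (W *m diagC h *m V) = W *m diagC (expR \o h) *m V.
Proof.
move=> VW WV; apply: expmx_conj_diag => // i; rewrite !mxE; exact: cvg_expC.
Qed.

Lemma gibbs_conj_diagC n (beta : R) (V W : 'M[C]_n) (h : 'I_n -> R) :
  V *m W = 1%:M -> W *m V = 1%:M ->
  gibbs beta (W *m diagC h *m V) = W *m diagC (gibbs_weight beta h) *m V.
Proof.
move=> VW WV; rewrite /gibbs.
have -> : - (beta%:C%C *: (W *m diagC h *m V)) = W *m diagC (fun i => - beta * h i) *m V.
  rewrite -scaleNr scalemxAl scalemxAr; congr (W *m _ *m V).
  by apply/matrixP => i j; rewrite !mxE mulrnAr rmorphM rmorphN.
rewrite expmx_conj_diagC// mxtrace_mulC mulmxA VW mul1mx.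
rewrite scalemxAl scalemxAr; congr (W *m _ *m V).
rewrite mxtrace_diag; apply/matrixP => i j; rewrite !mxE mulrnAr /gibbs_weight.
rewrite rmorphM fmorphV rmorph_sum/= mulrC; congr ((_ / _) *+ _).
by apply: eq_bigr => k _; rewrite mxE.
Qed.

Lemma hermitian_diagonalization n (H : 'M[C]_n) : H \is hermsymmx ->
  exists (V : 'M[C]_n) (h : 'I_n -> R),
    [/\ V \is unitarymx & H = V^t* *m diagC h *m V].
Proof.
move=> Hh; exists (spectralmx H), (fun i => complex.Re (spectral_diag H 0 i)).
split; first exact: spectral_unitarymx.
(* Taking real parts loses nothing: the spectrum of a Hermitian matrix is real. *)
have -> : diagC (fun i => complex.Re (spectral_diag H 0 i)) = diag_mx (spectral_diag H).
  congr diag_mx; apply/rowP => i; rewrite mxE RRe_real//.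
  by have /mxOverP := hermitian_spectral_diag_real Hh.
rewrite -(invmx_unitary (spectral_unitarymx H)).
exact/orthomx_spectralP/hermitian_normalmx.
Qed.

End Gibbs.

Section Adjoint.
Variable C : numClosedFieldType.

Lemma adjmxM m n p (A : 'M[C]_(m, n)) (B : 'M[C]_(n, p)) :
  (A *m B)^t* = B^t* *m A^t*.
Proof. by rewrite trmx_mul map_mxM. Qed.

Lemma adjmxD m n (A B : 'M[C]_(m, n)) : (A + B)^t* = A^t* + B^t*.
Proof. by rewrite linearD map_mxD. Qed.

Lemma adjmxB m n (A B : 'M[C]_(m, n)) : (A - B)^t* = A^t* - B^t*.
Proof. by rewrite linearB map_mxB. Qed.

Lemma adjmxMn m n (A : 'M[C]_(m, n)) k : (A *+ k)^t* = A^t* *+ k.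
Proof. by rewrite linearMn raddfMn. Qed.

Lemma adjmx_sign m n (s : bool) (A : 'M[C]_(m, n)) :
  ((-1) ^+ s *: A)^t* = (-1) ^+ s *: A^t*.
Proof.
by case: s; rewrite ?expr1 ?expr0 ?scaleN1r ?scale1r// linearN map_mxN.
Qed.

Lemma adjmx1 n : (1%:M : 'M[C]_n)^t* = 1%:M.
Proof. by rewrite trmx1 map_mx1. Qed.

Lemma adjmx_tens m n p q (A : 'M[C]_(m, n)) (B : 'M[C]_(p, q)) :
  (A *t B)^t* = A^t* *t B^t*.
Proof. by rewrite trmx_tens map_mxT. Qed.

Lemma adjmx_tens1 m n (A : 'M[C]_m) :
  (A *t (1%:M : 'M[C]_n))^t* = A^t* *t 1%:M.
Proof. by rewrite adjmx_tens adjmx1. Qed.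

Lemma adjmx_1tens m n (A : 'M[C]_m) :
  ((1%:M : 'M[C]_n) *t A)^t* = 1%:M *t A^t*.
Proof. by rewrite adjmx_tens adjmx1. Qed.

Lemma hermsymmxP n (A : 'M[C]_n) : A \is hermsymmx <-> A^t* = A.
Proof.
split; first by move=> /is_hermitianmxP; rewrite expr0 scale1r => <-.
by move=> AA; apply/is_hermitianmxP; rewrite expr0 scale1r.
Qed.

End Adjoint.

Section UnitSums.
Variable V : nmodType.

Lemma sum_unit (F : unit -> V) : \sum_x F x = F tt.
Proof. by rewrite (big_pred1 tt)//; case. Qed.

Lemma sum_pair_unit (E : finType) (F : E * unit -> V) :
  \sum_x F x = \sum_e F (e, tt).
Proof.
rewrite (eq_bigr (fun x => F (x.1, x.2))); last by case.
by rewrite -(pair_bigA _ (fun a b => F (a, b)))/=; apply: eq_bigr => e _; rewrite sum_unit.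
Qed.

Lemma sum_unit_pair (E : finType) (F : unit * E -> V) :
  \sum_x F x = \sum_e F (tt, e).
Proof.
rewrite (eq_bigr (fun x => F (x.1, x.2))); last by case.
by rewrite -(pair_bigA _ (fun a b => F (a, b)))/= sum_unit.
Qed.

Lemma sum_bool_unit (F : bool * unit -> V) :
  \sum_x F x = F (true, tt) + F (false, tt).
Proof. by rewrite sum_pair_unit big_bool. Qed.

Lemma sum_unit_bool (F : unit * bool -> V) :
  \sum_x F x = F (tt, true) + F (tt, false).
Proof. by rewrite sum_unit_pair big_bool. Qed.

End UnitSums.

Section GibbsWeight.
Variable R : realType.

Lemma sum_gibbs_weight (E : finType) (beta : R) (h : E -> R) :
  (0 < #|E|)%N -> \sum_e gibbs_weight beta h e = 1.
Proof.
move=> /card_gt0P[e0 _]; rewrite -mulr_suml divff// gt_eqF// (bigD1 e0)//=.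
by rewrite ltr_wpDr ?expR_gt0// sumr_ge0// => e _; exact: expR_ge0.
Qed.

Lemma gibbs_weight_pair (E F : finType) (beta : R) (h : E -> R) (k : F -> R) x :
  gibbs_weight beta (fun z : E * F => h z.1 + k z.2) x =
  gibbs_weight beta h x.1 * gibbs_weight beta k x.2.
Proof.
rewrite /gibbs_weight/= mulrDr expRD mulrACA -invfM; congr (_ / _).
rewrite mulr_suml -(pair_bigA _ (fun a b => expR (- beta * (h a + k b))))/=.
apply: eq_bigr => a _; rewrite mulr_sumr; apply: eq_bigr => b _.
by rewrite mulrDr expRD.
Qed.

(** The levels are chosen so that the Boltzmann factors are the [p e] themselves, and the partition
    function is then their sum, [1]. *)
Lemma gibbs_weight_log (E : finType) (beta : R) (p : E -> R) :
  beta != 0 -> (forall e, 0 < p e) -> \sum_e p e = 1 ->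
  gibbs_weight beta (fun e => - ln (p e) / beta) =1 p.
Proof.
move=> b0 p0 p1 e.
have pE f : expR (- beta * (- ln (p f) / beta)) = p f.
  by rewrite mulrC mulNr mulrNN divfK// lnK ?posrE.
by rewrite /gibbs_weight; under eq_bigr do rewrite pE; rewrite p1 divr1 pE.
Qed.

Lemma gibbs_weight_unit (beta : R) (h : unit -> R) : gibbs_weight beta h tt = 1.
Proof.
have := @sum_gibbs_weight unit beta h; rewrite card_unit => /(_ isT).
by rewrite sum_unit.
Qed.

(** A degenerate two-level bath is a fair coin at any temperature; it supplies the random sign. *)
Lemma gibbs_weight_bool0 (beta : R) (b : bool) :
  gibbs_weight beta (fun=> 0) b = 2^-1.
Proof. by rewrite /gibbs_weight big_bool/= !mulr0 expR0 div1r. Qed.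

End GibbsWeight.

Section Dilation.
Variables (R : realType) (d : nat).
Local Notation C := R[i].
Implicit Types (G X Y : 'M[C]_d) (c : R).

(** With this sign, [X] sends a [G]-eigenvector of value [E] to one of value [E - c] (or to [0]):
    [c] is the energy handed over to the bath. *)
Definition energy_shift G c X : Prop := X *m G - G *m X = c%:C%C *: X.

Lemma energy_shift0 G c : energy_shift G c 0.
Proof. by rewrite /energy_shift mul0mx mulmx0 subrr scaler0. Qed.

Lemma energy_shift1 G : energy_shift G 0 1%:M.
Proof. by rewrite /energy_shift mul1mx mulmx1 subrr scale0r. Qed.

Lemma energy_shiftD G c X Y :
  energy_shift G c X -> energy_shift G c Y -> energy_shift G c (X + Y).
Proof.
by move=> hX hY; rewrite /energy_shift mulmxDl mulmxDr opprD addrACA hX hY scalerDr.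
Qed.

Lemma energy_shiftN G c X : energy_shift G c X -> energy_shift G c (- X).
Proof.
by move=> hX; rewrite /energy_shift mulNmx mulmxN -opprD hX scalerN.
Qed.

(** The commutator with [G] is a derivation, so shifts add under products. *)
Lemma energy_shiftM G c c' X Y :
  energy_shift G c X -> energy_shift G c' Y -> energy_shift G (c + c') (X *m Y).
Proof.
move=> hX hY; rewrite /energy_shift rmorphD scalerDl.
rewrite (scalemxAl c%:C%C X Y) (scalemxAr c'%:C%C X Y) -hX -hY.
by rewrite mulmxBl mulmxBr !mulmxA [RHS]addrC addrA subrK.
Qed.

End Dilation.

(** * Dilations *)

Section Baths.
Variables A1 A2 B1 B2 : finType.
Implicit Types f e : ((A1 * A2) * (B1 * B2))%type.

(** Each party joins its own baths, so a joint level is grouped by party; these projections regroup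
    it by the channel that each pair of baths serves. *)
Definition fst_bath f : A1 * B1 := (f.1.1, f.2.1).
Definition snd_bath f : A2 * B2 := (f.1.2, f.2.2).

Lemma sum_baths (V : nmodType) (F : A1 * B1 -> A2 * B2 -> V) :
  \sum_f F (fst_bath f) (snd_bath f) = \sum_x \sum_y F x y.
Proof.
rewrite pair_bigA/= (reindex (fun f => (fst_bath f, snd_bath f)))//.
exists (fun z : (A1 * B1) * (A2 * B2) => ((z.1.1, z.2.1), (z.1.2, z.2.2))).
  by move=> [[a1 a2] [b1 b2]].
by move=> [[a1 b1] [a2 b2]].
Qed.

Lemma eq_baths f e :
  (f == e) = (fst_bath f == fst_bath e) && (snd_bath f == snd_bath e).
Proof.
by case: f e => [[a1 a2] [b1 b2]] [[? ?] [? ?]]; rewrite !xpair_eqE andbACA.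
Qed.

End Baths.

Section Dilations.
Variables (R : realType) (d : nat) (betaA betaB : R).
Local Notation C := R[i].
Variables (G1 G2 : 'M[C]_d).

(* [G1] stands for the Hamiltonian of the system and [G2] for its combination
   weighted by the inverse temperatures; the bath levels [hA] and [hB] enter the
   two conservation laws with weights [1] and [betaA], [betaB] respectively. *)
Record dilation (EA EB : finType) (hA : EA -> R) (hB : EB -> R)
    (W : EA * EB -> EA * EB -> 'M[C]_d) (L : channel R d) : Prop := Dilation {
  dilation_isometry : forall e e',
    \sum_f (W f e)^t* *m W f e' = 1%:M *+ (e == e');
  dilation_shift1 : forall f e,
    energy_shift G1 ((hA f.1 + hB f.2) - (hA e.1 + hB e.2)) (W f e);
  dilation_shift2 : forall f e,
    energy_shift G2 ((betaA * hA f.1 + betaB * hB f.2) -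
                     (betaA * hA e.1 + betaB * hB e.2)) (W f e);
  dilation_kraus : forall rho, L rho = \sum_f \sum_e
    (gibbs_weight betaA hA e.1 * gibbs_weight betaB hB e.2)%:C%C *:
      (W f e *m rho *m (W f e)^t*) }.

Lemma eq_dilation (EA EB : finType) (hA : EA -> R) (hB : EB -> R) W (L L' : channel R d) :
  (forall rho, L rho = L' rho) -> dilation hA hB W L -> dilation hA hB W L'.
Proof. by move=> LL' [W1 W2 W3 W4]; split=> // rho; rewrite -LL'. Qed.

Lemma sum_gibbs_weight2 (EA EB : finType) (hA : EA -> R) (hB : EB -> R) :
  (0 < #|EA|)%N -> (0 < #|EB|)%N ->
  \sum_(e : EA * EB) gibbs_weight betaA hA e.1 * gibbs_weight betaB hB e.2 = 1.
Proof.
move=> EA0 EB0.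
rewrite -(pair_bigA _ (fun a b => gibbs_weight betaA hA a * gibbs_weight betaB hB b))/=.
under eq_bigr do rewrite -mulr_sumr sum_gibbs_weight// mulr1.
exact: sum_gibbs_weight.
Qed.

(** An operator that leaves the bath level alone sees the Gibbs weights only through their sum,
    [1]. *)
Lemma sum_delta_kraus (EA EB : finType) (hA : EA -> R) (hB : EB -> R) (X rho : 'M[C]_d) :
  (0 < #|EA|)%N -> (0 < #|EB|)%N ->
  \sum_(f : EA * EB) \sum_e
    (gibbs_weight betaA hA e.1 * gibbs_weight betaB hB e.2)%:C%C *:
      ((X *+ (f == e)) *m rho *m (X *+ (f == e))^t*) = X *m rho *m X^t*.
Proof.
move=> EA0 EB0; rewrite exchange_big/=.
rewrite (eq_bigr (fun e => (gibbs_weight betaA hA e.1 * gibbs_weight betaB hB e.2)%:C%C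
    *: (X *m rho *m X^t*))) => [|e _].
  by rewrite -scaler_suml -rmorph_sum sum_gibbs_weight2// scale1r.
rewrite (bigD1 e)//= eqxx mulr1n big1 ?addr0// => f /negPf->.
by rewrite mulr0n !mul0mx scaler0.
Qed.

Lemma dilation_id (EA EB : finType) (hA : EA -> R) (hB : EB -> R) :
  (0 < #|EA|)%N -> (0 < #|EB|)%N ->
  dilation hA hB (fun f e => 1%:M *+ (f == e)) id.
Proof.
move=> EA0 EB0; split=> [e e'|f e|f e|rho].
- rewrite (bigD1 e)//= eqxx mulr1n adjmx1 mul1mx big1 ?addr0// => f /negPf->.
  by rewrite adjmxMn mul0mx.
- by case: eqVneq => [->|_]; rewrite ?subrr; [exact: energy_shift1|exact: energy_shift0].
- by case: eqVneq => [->|_]; rewrite ?subrr; [exact: energy_shift1|exact: energy_shift0].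
- by rewrite sum_delta_kraus// adjmx1 mul1mx mulmx1.
Qed.

Lemma dilation_comp (EA EB FA FB : finType) (hA : EA -> R) (hB : EB -> R)
    (kA : FA -> R) (kB : FB -> R) W V L M :
  dilation hA hB W L -> dilation kA kB V M ->
  dilation (fun x : EA * FA => hA x.1 + kA x.2) (fun x : EB * FB => hB x.1 + kB x.2)
    (fun f e => W (fst_bath f) (fst_bath e) *m V (snd_bath f) (snd_bath e))
    (L \o M).
Proof.
move=> [Wi W1 W2 Wk] [Vi V1 V2 Vk]; split=> [e e'|f e|f e|rho].
- rewrite (sum_baths (fun x y => (W x (fst_bath e) *m V y (snd_bath e))^t* *m
    (W x (fst_bath e') *m V y (snd_bath e')))) exchange_big/=.
  (* Summing over the bath of [W] first replaces the inner product of [W] blocks by a delta, after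
     which the isometry of [V] finishes. *)
  under eq_bigr => y _.
    under eq_bigr do rewrite adjmxM mulmxA -(mulmxA _ _ (W _ _)).
    rewrite -mulmx_suml -mulmx_sumr Wi.
    over.
  rewrite eq_baths; case: eqVneq => _ /=.
    by under eq_bigr do rewrite mulr1n mulmx1; rewrite Vi.
  by rewrite big1// => y _; rewrite mulr0n mulmx0 mul0mx.
- have := energy_shiftM (W1 (fst_bath f) (fst_bath e)) (V1 (snd_bath f) (snd_bath e)).
  by congr (energy_shift _ _ _) => /=; ring.
- have := energy_shiftM (W2 (fst_bath f) (fst_bath e)) (V2 (snd_bath f) (snd_bath e)).
  by congr (energy_shift _ _ _) => /=; ring.
- rewrite /= Wk.
  set gE := fun e : EA * EB => gibbs_weight betaA hA e.1 * gibbs_weight betaB hB e.2.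
  set gF := fun e : FA * FB => gibbs_weight betaA kA e.1 * gibbs_weight betaB kB e.2.
  transitivity (\sum_f \sum_f' \sum_e \sum_e' (gE e * gF e')%:C%C *:
      (W f e *m V f' e' *m rho *m (W f e *m V f' e')^t*)).
    apply: eq_bigr => f _; rewrite [RHS]exchange_big/=; apply: eq_bigr => e _.
    rewrite Vk mulmx_sumr mulmx_suml scaler_sumr; apply: eq_bigr => f' _.
    rewrite mulmx_sumr mulmx_suml scaler_sumr; apply: eq_bigr => e' _.
    by rewrite adjmxM -scalemxAr -scalemxAl scalerA -rmorphM !mulmxA.
  rewrite -(sum_baths (fun f f' => \sum_e \sum_e' (gE e * gF e')%:C%C *:
      (W f e *m V f' e' *m rho *m (W f e *m V f' e')^t*))).
  apply: eq_bigr => f _.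
  rewrite -(sum_baths (fun e e' => (gE e * gF e')%:C%C *:
      (W _ e *m V _ e' *m rho *m (W _ e *m V _ e')^t*))).
  by apply: eq_bigr => e _; rewrite !gibbs_weight_pair mulrACA.
Qed.

(** The register [x] is a classical control: the dilation is block diagonal in [x], so [x] keeps its
    level and only contributes its Gibbs weight. All the [L x] must run on the same bath. *)
Lemma dilation_mix (XA XB EA EB : finType) (kA : XA -> R) (kB : XB -> R)
    (hA : EA -> R) (hB : EB -> R) W (L : XA * XB -> channel R d) :
  (forall x, dilation hA hB (W x) (L x)) ->
  dilation (fun x : XA * EA => kA x.1 + hA x.2) (fun x : XB * EB => kB x.1 + hB x.2)
    (fun f e => W (fst_bath e) (snd_bath f) (snd_bath e) *+ (fst_bath f == fst_bath e))
    (fun rho => \sum_x (gibbs_weight betaA kA x.1 * gibbs_weight betaB kB x.2)%:C%C *: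
                  L x rho).
Proof.
move=> WL; split=> [e e'|f e|f e|rho].
- rewrite (sum_baths (fun x y =>
    (W (fst_bath e) y (snd_bath e) *+ (x == fst_bath e))^t* *m
    (W (fst_bath e') y (snd_bath e') *+ (x == fst_bath e')))).
  rewrite (bigD1 (fst_bath e))//= [X in _ + X]big1 ?addr0 => [|x /negPf xe]; last first.
    by rewrite big1// => y _; rewrite xe adjmxMn mulr0n mul0mx.
  rewrite eqxx eq_baths; case: eqVneq => [<-|_].
    by have := dilation_isometry (WL (fst_bath e)) (snd_bath e) (snd_bath e').
  by rewrite big1// => y _; rewrite mulr0n mulmx0.
- case: eqVneq => [E|_]; last exact: energy_shift0.
  have := dilation_shift1 (WL (fst_bath e)) (snd_bath f) (snd_bath e).
  have [/= -> ->] := (congr1 fst E, congr1 snd E).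
  by congr (energy_shift _ _ _) => /=; ring.
- case: eqVneq => [E|_]; last exact: energy_shift0.
  have := dilation_shift2 (WL (fst_bath e)) (snd_bath f) (snd_bath e).
  have [/= -> ->] := (congr1 fst E, congr1 snd E).
  by congr (energy_shift _ _ _) => /=; ring.
- set gX := fun x : XA * XB => gibbs_weight betaA kA x.1 * gibbs_weight betaB kB x.2.
  set gE := fun e : EA * EB => gibbs_weight betaA hA e.1 * gibbs_weight betaB hB e.2.
  pose K f f' e e' := (gX e * gE e')%:C%C *:
    ((W e f' e' *+ (f == e)) *m rho *m (W e f' e' *+ (f == e))^t*).
  transitivity (\sum_f \sum_f' \sum_e \sum_e' K f f' e e'); last first.
    rewrite -(sum_baths (fun f f' => \sum_e \sum_e' K f f' e e')).
    apply: eq_bigr => f _; rewrite -(sum_baths (K _ _)).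
    by apply: eq_bigr => e _; rewrite /K /= !gibbs_weight_pair mulrACA.
  apply: eq_bigr => x _; rewrite (dilation_kraus (WL x)) scaler_sumr.
  apply: eq_bigr => f' _; rewrite (bigD1 x)//= [X in _ + X]big1 ?addr0 => [|e]; last first.
    rewrite eq_sym => /negPf xe; rewrite big1// => e' _.
    by rewrite /K xe mulr0n !mul0mx scaler0.
  rewrite scaler_sumr; apply: eq_bigr => e' _.
  by rewrite /K eqxx mulr1n scalerA -rmorphM.
Qed.

(* With [P] and [1 - P] reducing [W], averaging over the two signs in
   [P *m W +/- (1 - P)] kills the coherences between the ranges of [P] and
   [1 - P]. *)
Lemma dilation_signed (EA EB : finType) (hA : EA -> R) (hB : EB -> R) W L P (s : bool) :
  dilation hA hB W L -> P^t* = P -> P *m P = P ->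
  energy_shift G1 0 P -> energy_shift G2 0 P -> (forall f e, comm_mx P (W f e)) ->
  let V f e := P *m W f e + (-1) ^+ s *: ((1%:M - P) *+ (f == e)) in
  dilation hA hB V (fun rho => \sum_f \sum_e
    (gibbs_weight betaA hA e.1 * gibbs_weight betaB hB e.2)%:C%C *:
      (V f e *m rho *m (V f e)^t*)).
Proof.
move=> [Wi W1 W2 _] PP PK P1 P2 PW V.
have Q1 G : energy_shift G 0 P -> energy_shift G 0 (1%:M - P).
  by move=> ?; apply: energy_shiftD; [exact: energy_shift1|exact: energy_shiftN].
(* The summand with [1 - P] occurs only for [f = e], where the required shift is [0]; elsewhere it
   vanishes and has every shift. *)
have shiftV G c f e : energy_shift G 0 P -> energy_shift G c (W f e) ->
    (f = e -> c = 0) -> energy_shift G c (V f e).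
  move=> GP GW fe; apply: energy_shiftD.
    by rewrite -[c]add0r; exact: energy_shiftM.
  case: eqVneq => [/fe->|_]; last by rewrite scaler0; exact: energy_shift0.
  by case: (s); rewrite ?scaleN1r ?scale1r; [apply: energy_shiftN|]; exact: Q1.
have PQ : P *m (1%:M - P) = 0 by rewrite mulmxBr mulmx1 PK subrr.
have QP : (1%:M - P) *m P = 0 by rewrite mulmxBl mul1mx PK subrr.
have QQ : (1%:M - P)^t* *m (1%:M - P) = 1%:M - P.
  by rewrite adjmxB adjmx1 PP mulmxBl PQ mul1mx subr0.
split=> // [e e'|f e|f e]; last 2 first.
- by apply: shiftV => // ->; rewrite subrr.
- by apply: shiftV => // ->; rewrite subrr.
(* Since [P] commutes with [W], the cross terms contain [P] times [1 - P] and vanish, while the sign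
   squares to [1]. *)
have VV f : (V f e)^t* *m V f e' =
    P *m ((W f e)^t* *m W f e') + (1%:M - P) *+ ((f == e) && (f == e')).
  have WP : (W f e)^t* *m P = P *m (W f e)^t*.
    by rewrite -{1}PP -adjmxM PW adjmxM PP.
  rewrite adjmxD adjmxM PP adjmx_sign adjmxMn mulmxDl !mulmxDr.
  rewrite -!scalemxAl -!scalemxAr scalerA -signr_addb addbb scale1r.
  have -> : W f e ^t* *m P *m (P *m W f e') = P *m (W f e ^t* *m W f e').
    by rewrite mulmxA -(mulmxA _ P P) PK WP -mulmxA.
  have -> : W f e ^t* *m P *m ((1%:M - P) *+ (f == e')) = 0.
    by rewrite -mulmxA; case: (f == e'); rewrite ?mulr1n ?PQ ?mulr0n !mulmx0.
  have -> : ((1%:M - P)^t* *+ (f == e)) *m (P *m W f e') = 0.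
    rewrite adjmxB adjmx1 PP mulmxA.
    by case: (f == e); rewrite ?mulr1n ?QP ?mulr0n !mul0mx.
  rewrite !scaler0 addr0 add0r; congr (_ + _).
  by case: (f == e); case: (f == e'); rewrite /= ?mulr1n ?mulr0n ?QQ ?mulmx0 ?mul0mx.
under eq_bigr do rewrite VV.
rewrite big_split/= -mulmx_sumr Wi (bigD1 e)//= eqxx big1 ?addr0 => [|f /negPf->//].
by case: (e == e'); rewrite ?mulr1n ?mulr0n ?mulmx1 ?mulmx0 ?addr0// addrC subrK.
Qed.

End Dilations.

(** * Closure properties of semilocal channels *)

(** The cross terms are odd in the sign and cancel in the average; the diagonal ones are even. *)
Lemma average_sign_kraus (C : numClosedFieldType) d (E : finType) (g : E -> C)
    (X Y : E -> E -> 'M[C]_d) rho :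
  let S (b : bool) := \sum_f \sum_e g e *:
    ((X f e + (-1) ^+ b *: Y f e) *m rho *m (X f e + (-1) ^+ b *: Y f e)^t*) in
  2^-1 *: (S true + S false) =
  (\sum_f \sum_e g e *: (X f e *m rho *m (X f e)^t*)) +
  (\sum_f \sum_e g e *: (Y f e *m rho *m (Y f e)^t*)).
Proof.
rewrite /= -!big_split scaler_sumr; apply: eq_bigr => f _ /=.
rewrite -!big_split scaler_sumr; apply: eq_bigr => e _ /=.
rewrite -!scalerDr scalerA mulrC -scalerA; congr (_ *: _).
move: (X f e) (Y f e) => {}X {}Y.
rewrite expr1 expr0 scale1r scaleN1r adjmxB adjmxD.
rewrite !mulmxDl !mulmxDr !mulNmx !mulmxN opprK.
set a := X *m rho *m _; set b := X *m rho *m _; set c := Y *m rho *m _.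
set e' := Y *m rho *m _.
have -> : a - b + (- c + e') + (a + b + (c + e')) = 2 *: (a + e').
  rewrite addrACA [a - b + _]addrACA addNr addr0 [- c + _ + _]addrACA addNr add0r.
  by rewrite addrACA scaler_nat mulr2n.
by rewrite scalerA mulVf ?scale1r// pnatr_eq0.
Qed.

Section Semilocal.
Variables (R : realType) (d : nat) (betaA betaB : R).
Local Notation C := R[i].
Variables (G1 G2 : 'M[C]_d).

Definition semilocal : set (channel R d) :=
  [set L | exists (EA EB : finType) (hA : EA -> R) (hB : EB -> R) W,
    [/\ (0 < #|EA|)%N, (0 < #|EB|)%N & dilation betaA betaB G1 G2 hA hB W L]].

Lemma eq_semilocal (L L' : channel R d) :
  (forall rho, L rho = L' rho) -> semilocal L -> semilocal L'.
Proof.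
move=> LL' [EA [EB [hA [hB [W [EA0 EB0 WL]]]]]].
by exists EA, EB, hA, hB, W; split=> //; apply: eq_dilation WL.
Qed.

Lemma semilocal_id : semilocal id.
Proof.
exists unit, unit, (fun=> 0), (fun=> 0), (fun f e => 1%:M *+ (f == e)).
by split; rewrite ?card_unit//; apply: dilation_id; rewrite card_unit.
Qed.

Lemma semilocal_comp L M : semilocal L -> semilocal M -> semilocal (L \o M).
Proof.
move=> [EA [EB [hA [hB [W [EA0 EB0 WL]]]]]] [FA [FB [kA [kB [V [FA0 FB0 VM]]]]]].
do 5 eexists; split; last exact: dilation_comp WL VM.
  by rewrite card_prod muln_gt0 EA0.
by rewrite card_prod muln_gt0 EB0.
Qed.

(** The coin for the sign is stored in the first party's bath, at level [0], with [unit] as the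
    second party's register. On the range of [P] the channel [L] is run; on the complement nothing
    happens, so further outcomes can still be measured there. *)
Lemma semilocal_measure (EA EB : finType) (hA : EA -> R) (hB : EB -> R) W L P :
  (0 < #|EA|)%N -> (0 < #|EB|)%N ->
  dilation betaA betaB G1 G2 hA hB W L ->
  P^t* = P -> P *m P = P -> comm_mx P G1 -> comm_mx P G2 ->
  (forall f e, comm_mx P (W f e)) ->
  semilocal (fun rho => L (P *m rho *m P) + (1%:M - P) *m rho *m (1%:M - P)).
Proof.
move=> EA0 EB0 WL PP PK P1 P2 PW.
have shiftP G : comm_mx P G -> energy_shift G 0 P.
  by move=> PG; rewrite /energy_shift PG subrr scale0r.
have mixL := dilation_mix (fun=> 0 : R) (fun=> 0 : R) (fun x : bool * unit =>
  dilation_signed x.1 WL PP PK (shiftP _ P1) (shiftP _ P2) PW).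
do 5 eexists; split; last first.
- apply: eq_dilation mixL => rho.
  rewrite sum_bool_unit/=.
  rewrite !gibbs_weight_unit !mulr1.
  rewrite !gibbs_weight_bool0 -scalerDr fmorphV rmorph_nat.
  rewrite average_sign_kraus; congr (_ + _).
    rewrite (dilation_kraus WL); apply: eq_bigr => f _; apply: eq_bigr => e _.
    by rewrite PW adjmxM PP !mulmxA.
  by rewrite (sum_delta_kraus betaA betaB hA hB _ _ EA0 EB0) adjmxB adjmx1 PP.
- by rewrite card_prod card_unit muln_gt0 EB0.
- by rewrite card_prod card_bool muln_gt0 EA0.
Qed.

Lemma semilocal_convex2 (p : bool -> R) L :
  (betaA != 0) || (betaB != 0) -> (forall b, 0 < p b) -> p true + p false = 1 ->
  (forall b, semilocal (L b)) ->
  semilocal (fun rho => (p true)%:C%C *: L true rho + (p false)%:C%C *: L false rho).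
Proof.
move=> beta0 p0 p1 semiL.
(* Mixing requires a common bath: take the product of the two, each channel idling on the bath of
   the other. *)
have [EA [EB [hA [hB [W [EA0 EB0 WL]]]]]] : exists (EA EB : finType)
    (hA : EA -> R) (hB : EB -> R) (W : bool -> EA * EB -> EA * EB -> 'M[C]_d),
    [/\ (0 < #|EA|)%N, (0 < #|EB|)%N &
        forall b, dilation betaA betaB G1 G2 hA hB (W b) (L b)].
  have [EA [EB [hA [hB [W [EA0 EB0 WL]]]]]] := semiL true.
  have [FA [FB [kA [kB [V [FA0 FB0 VM]]]]]] := semiL false.
  have WT := dilation_comp WL (dilation_id betaA betaB G1 G2 kA kB FA0 FB0).
  have WF := dilation_comp (dilation_id betaA betaB G1 G2 hA hB EA0 EB0) VM.
  do 4 eexists; exists (fun (b : bool) f e => if b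
      then W (fst_bath f) (fst_bath e) *m (1%:M *+ (snd_bath f == snd_bath e))
      else 1%:M *+ (fst_bath f == fst_bath e) *m V (snd_bath f) (snd_bath e)).
  split; last by case; [exact: WT|exact: WF].
  - by rewrite card_prod muln_gt0 EA0.
  - by rewrite card_prod muln_gt0 EB0.
have sump : \sum_b p b = 1 by rewrite big_bool.
(* The biased coin goes into the bath of a party whose inverse temperature is nonzero. *)
have [bA0|bB0] := orP beta0.
- have mixL := dilation_mix (fun b => - ln (p b) / betaA) (fun=> 0 : R)
    (fun x : bool * unit => WL x.1).
  do 5 eexists; split; last first.
  + apply: eq_dilation mixL => rho.
    rewrite sum_bool_unit/=.
    by rewrite !gibbs_weight_unit !mulr1 !gibbs_weight_log.
  + by rewrite card_prod card_unit muln_gt0 EB0.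
  + by rewrite card_prod card_bool muln_gt0 EA0.
- have mixL := dilation_mix (fun=> 0 : R) (fun b => - ln (p b) / betaB)
    (fun x : unit * bool => WL x.2).
  do 5 eexists; split; last first.
  + apply: eq_dilation mixL => rho.
    rewrite sum_unit_bool/=.
    by rewrite !gibbs_weight_unit !mul1r !gibbs_weight_log.
  + by rewrite card_prod card_bool muln_gt0 EB0.
  + by rewrite card_prod card_unit muln_gt0 EA0.
Qed.

(** Weights are normalised in the conclusion so that the induction applies to the tail of the
    family, whose weights no longer sum to [1]. *)
Lemma semilocal_convex m (p : 'I_m -> R) (L : 'I_m -> channel R d) :
  (betaA != 0) || (betaB != 0) -> (forall i, 0 <= p i) -> 0 < \sum_i p i ->
  (forall i, semilocal (L i)) ->
  semilocal (fun rho => \sum_i (p i / \sum_j p j)%:C%C *: L i rho).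
Proof.
move=> beta0; elim: m p L => [|m IHm] p L p0 sp0 semiL.
  by rewrite big_ord0 ltxx in sp0.
rewrite big_ord_recl in sp0 *.
set s := \sum_(i < m) p (lift ord0 i) in sp0 *.
have s0 : 0 <= s by exact: sumr_ge0.
(* Zero weights are split off, here for the tail and below for the head, because the coin levels are
   logarithms of the weights. *)
have [ps0|ps0] := eqVneq s 0.
  apply: eq_semilocal (semiL ord0) => rho.
  rewrite big_ord_recl ps0 addr0 divff; last by rewrite ps0 addr0 in sp0; rewrite gt_eqF.
  rewrite scale1r big1 ?addr0// => i _.
  by rewrite (eqP (_ : p _ == 0)) ?mul0r ?scale0r// (psumr_eq0P _ ps0).
have {s0 ps0} s0 : 0 < s by rewrite lt0r ps0.
have {}IHm := IHm (fun i => p (lift ord0 i)) (fun i => L (lift ord0 i)) (fun=> p0 _) s0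
  (fun=> semiL _).
have [p00|p00] := eqVneq (p ord0) 0.
  apply: eq_semilocal IHm => rho.
  by rewrite big_ord_recl p00 mul0r scale0r !add0r.
have {p00} p00 : 0 < p ord0 by rewrite lt0r p00 p0.
have := @semilocal_convex2 (fun b => (if b then p ord0 else s) / (p ord0 + s))
  (fun b => if b then L ord0 else fun rho =>
     \sum_i (p (lift ord0 i) / s)%:C%C *: L (lift ord0 i) rho).
move=> /(_ beta0) H; apply: eq_semilocal (H _ _ _) => [rho|[]|/=|[]//].
- rewrite /= big_ord_recl; congr (_ + _); rewrite scaler_sumr; apply: eq_bigr => i _.
  rewrite scalerA -rmorphM; congr (_%:C%C *: _).
  by rewrite [LHS]mulrC mulrA divfK// gt_eqF.
- by rewrite divr_gt0.
- by rewrite divr_gt0.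
- by rewrite -mulrDl divff// gt_eqF.
Qed.

End Semilocal.

(** * Block decomposition of unitaries *)

Section TensorProduct.
Variable K : pzRingType.

Lemma tensmx11 m n :
  (1%:M : 'M[K]_m) *t (1%:M : 'M[K]_n) = 1%:M.
Proof.
apply/matrixP => x y; case: (mxtens_indexP x) => i j; case: (mxtens_indexP y) => k l.
rewrite tensmxE !mxE (can_eq (@mxtens_indexK _ _)) xpair_eqE.
by case: (i == k); rewrite /= ?mul1r ?mul0r.
Qed.

Lemma tensmx_suml (I : finType) m n p q (A : I -> 'M[K]_(m, n)) (B : 'M[K]_(p, q)) :
  (\sum_i A i) *t B = \sum_i A i *t B.
Proof.
apply/matrixP => x y; rewrite mxE !summxE mulr_suml.
by apply: eq_bigr => i _; rewrite mxE.
Qed.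

Lemma tensmx_sumr (I : finType) m n p q (A : 'M[K]_(m, n)) (B : I -> 'M[K]_(p, q)) :
  A *t (\sum_i B i) = \sum_i A *t B i.
Proof.
apply/matrixP => x y; rewrite mxE !summxE mulr_sumr.
by apply: eq_bigr => i _; rewrite mxE.
Qed.

Lemma tensmx_delta m n p q (i : 'I_m) (j : 'I_n) (k : 'I_p) (l : 'I_q) :
  delta_mx i j *t delta_mx k l =
  delta_mx (mxtens_index (i, k)) (mxtens_index (j, l)) :> 'M[K]_(_, _).
Proof.
apply/matrixP => x y; case: (mxtens_indexP x) => a b; case: (mxtens_indexP y) => c e.
rewrite tensmxE !mxE !(can_eq (@mxtens_indexK _ _)) !xpair_eqE.
by rewrite -natrM mulnb andbACA.
Qed.

Lemma sum_mxtens_index (V : nmodType) m n (F : 'I_(m * n) -> V) :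
  \sum_x F x = \sum_i \sum_k F (mxtens_index (i, k)).
Proof.
rewrite pair_bigA/= (reindex (@mxtens_index m n))/=; first by apply: eq_bigr => -[].
by exists (@mxtens_unindex m n) => x _; [exact: mxtens_indexK|exact: mxtens_unindexK].
Qed.

End TensorProduct.

Lemma tensmx_split (K : comPzRingType) m n p q (A : 'M[K]_(m, n)) (B : 'M[K]_(p, q)) :
  (A *t B = (A *t 1%:M) *m (1%:M *t B)) * (A *t B = (1%:M *t B) *m (A *t 1%:M)).
Proof. by rewrite !tensmx_mul !mul1mx !mulmx1. Qed.

Section UnitaryConjugation.
Variables (C : numClosedFieldType) (n : nat) (S : 'M[C]_n).

Lemma conj_unitarymx U : S \is unitarymx -> U \is unitarymx ->
  S *m U *m S^t* \is unitarymx.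
Proof. by move=> Su Uu; rewrite !mul_unitarymx ?trmxC_unitary. Qed.

Lemma conj_comm_mx U T : S \is unitarymx -> comm_mx U T ->
  comm_mx (S *m U *m S^t*) (S *m T *m S^t*).
Proof.
move=> /unitarymxP /mulmx1C SS UT.
rewrite /comm_mx !mulmxA -(mulmxA _ _ S) SS mulmx1 -(mulmxA _ _ S) SS mulmx1.
by rewrite -(mulmxA S) UT mulmxA.
Qed.

Lemma conj_kraus U X :
  (S *m U *m S^t*) *m X *m (S *m U *m S^t*)^t* =
  S *m (U *m (S^t* *m X *m S) *m U^t*) *m S^t*.
Proof. by rewrite !adjmxM trmxCK !mulmxA. Qed.

End UnitaryConjugation.

Section Blocks.
Variables (R : realType) (E : finType) (d N : nat).
Local Notation C := R[i].
Variable ix : E * 'I_d -> 'I_N.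
Hypothesis ix_bij : bijective ix.

(** The index bijection is abstract because thermal operations put the system before the bath, and
    semilocal ones put it after. *)
Definition blk (U : 'M[C]_N) (f e : E) : 'M[C]_d :=
  \matrix_(i, j) U (ix (f, i)) (ix (e, j)).

Lemma sum_ix (V : nmodType) (F : 'I_N -> V) :
  \sum_k F k = \sum_f \sum_i F (ix (f, i)).
Proof.
rewrite pair_bigA/= (reindex ix)/=; last exact: onW_bij.
by apply: eq_bigr => -[].
Qed.

Lemma eq_blk U V : (forall f e, blk U f e = blk V f e) -> U = V.
Proof.
move=> UV; apply/matrixP => x y; have [ix' ixK ix'K] := ix_bij.
rewrite -(ix'K x) -(ix'K y); case: (ix' x) (ix' y) => [f i] [e j].
by have /matrixP/(_ i j) := UV f e; rewrite !mxE.
Qed.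

Lemma blk_surj (W : E -> E -> 'M[C]_d) : exists U, forall f e, blk U f e = W f e.
Proof.
have [ix' ixK ix'K] := ix_bij.
exists (\matrix_(x, y) W (ix' x).1 (ix' y).1 (ix' x).2 (ix' y).2) => f e.
by apply/matrixP => i j; rewrite !mxE !ixK.
Qed.

Lemma blk_mul U V f e : blk (U *m V) f e = \sum_g blk U f g *m blk V g e.
Proof.
apply/matrixP => i j; rewrite !mxE sum_ix summxE; apply: eq_bigr => g _.
by rewrite mxE; apply: eq_bigr => k _; rewrite !mxE.
Qed.

Lemma blk_adj U f e : blk (U^t*) f e = (blk U e f)^t*.
Proof. by apply/matrixP => i j; rewrite !mxE. Qed.

Lemma blk1 f e : blk 1%:M f e = 1%:M *+ (f == e).
Proof.
apply/matrixP => i j; rewrite !mxE (bij_eq ix_bij) xpair_eqE.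
by case: eqVneq => _; rewrite /= ?mulr1n ?mulr0n !mxE.
Qed.

Lemma blk_unitary U : U \is unitarymx ->
  forall e e', \sum_f (blk U f e)^t* *m blk U f e' = 1%:M *+ (e == e').
Proof.
move=> /unitarymxP /mulmx1C UU e e'; rewrite -blk1 -UU blk_mul.
by apply: eq_bigr => f _; rewrite blk_adj.
Qed.

(** The block identity says that [U] is an isometry; being square, it is then unitary. *)
Lemma unitary_blk U :
  (forall e e', \sum_f (blk U f e)^t* *m blk U f e' = 1%:M *+ (e == e')) ->
  U \is unitarymx.
Proof.
move=> UU; apply/unitarymxP/mulmx1C/eq_blk => e e'; rewrite blk1 -UU blk_mul.
by apply: eq_bigr => f _; rewrite blk_adj.
Qed.

Lemma blk_mul_diag U T (D : E -> 'M[C]_d) f e :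
  (forall f e, blk T f e = D e *+ (f == e)) ->
  blk (U *m T) f e = blk U f e *m D e.
Proof.
move=> TD; rewrite blk_mul (bigD1 e)//= TD eqxx mulr1n big1 ?addr0// => g /negPf ge.
by rewrite TD ge mulr0n mulmx0.
Qed.

Lemma blk_diag_mul U T (D : E -> 'M[C]_d) f e :
  (forall f e, blk T f e = D e *+ (f == e)) ->
  blk (T *m U) f e = D f *m blk U f e.
Proof.
move=> TD; rewrite blk_mul (bigD1 f)//= TD eqxx mulr1n big1 ?addr0// => g /negPf ge.
by rewrite TD eq_sym ge mulr0n mul0mx.
Qed.

(** As [T] is block diagonal, block [(f, e)] of the commutator only involves [blk U f e], multiplied
    by [G + c e] on the right and [G + c f] on the left. *)
Lemma comm_blk U T (G : 'M[C]_d) (c : E -> R) :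
  (forall f e, blk T f e = (G + (c e)%:C%C%:M) *+ (f == e)) ->
  comm_mx U T <-> forall f e, energy_shift G (c f - c e) (blk U f e).
Proof.
move=> TG; have shiftE f e : energy_shift G (c f - c e) (blk U f e) <->
    blk (U *m T) f e = blk (T *m U) f e.
  rewrite (blk_mul_diag U f e TG) (blk_diag_mul U f e TG) mulmxDr mulmxDl.
  rewrite mul_mx_scalar mul_scalar_mx /energy_shift rmorphB scalerBl.
  move: (_ *m G) (G *m _) ((c f)%:C%C *: _) ((c e)%:C%C *: _) => x y z w; split=> [xy|xw].
    by rewrite -[x](subrK y) xy addrAC subrK addrC.
  have -> : x = y + z - w by rewrite -xw addrK.
  by rewrite addrAC [y + z]addrC addrK.
split=> [UT f e|UT]; first by apply/shiftE; rewrite UT.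
by apply: eq_blk => f e; apply/shiftE.
Qed.

Lemma blk_kraus U T rho (g : E -> C) :
  (forall f e, blk T f e = (g e *: rho) *+ (f == e)) ->
  \sum_f blk (U *m T *m U^t*) f f =
  \sum_f \sum_e g e *: (blk U f e *m rho *m (blk U f e)^t*).
Proof.
move=> TD; apply: eq_bigr => f _; rewrite blk_mul; apply: eq_bigr => e _.
by rewrite (blk_mul_diag U f e TD) blk_adj -scalemxAr -scalemxAl.
Qed.

End Blocks.

(** * Block form of local thermal operations *)

Section LocalDilation.
Variables (R : realType) (d : nat) (beta : R).
Local Notation C := R[i].
Variable H : 'M[C]_d.

Record local_dilation (E : finType) (h : E -> R) (W : E -> E -> 'M[C]_d)
    (L : channel R d) : Prop := LocalDilation {
  local_isometry : forall e e',
    \sum_f (W f e)^t* *m W f e' = 1%:M *+ (e == e');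
  local_shift : forall f e, energy_shift H (h f - h e) (W f e);
  local_kraus : forall rho, L rho = \sum_f \sum_e
    (gibbs_weight beta h e)%:C%C *: (W f e *m rho *m (W f e)^t*) }.

Definition sys_bath n (x : 'I_n * 'I_d) : 'I_(d * n) := mxtens_index (x.2, x.1).

Lemma sys_bath_bij n : bijective (@sys_bath n).
Proof.
exists (fun k => ((mxtens_unindex k).2, (mxtens_unindex k).1)) => [[f i]|k].
  by rewrite /sys_bath mxtens_indexK.
exact: (mxtens_unindexK k).
Qed.

Lemma blk_sys_bath n (X : 'M[C]_d) (K : 'M[C]_n) f e :
  blk (@sys_bath n) (X *t K) f e = K f e *: X.
Proof. by apply/matrixP => i j; rewrite !mxE !mxtens_indexK/= mulrC. Qed.

Lemma ptrace2_blk n (X : 'M[C]_(d * n)) : ptrace2 X = \sum_f blk (@sys_bath n) X f f.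
Proof.
by apply/matrixP => i j; rewrite mxE summxE; apply: eq_bigr => f _; rewrite mxE.
Qed.

(** Cyclicity of the partial trace for operators on the traced factor; a change of basis of the bath
    is thus invisible on the system. *)
Lemma ptrace2_conj n (A B : 'M[C]_n) (X : 'M[C]_(d * n)) : B *m A = 1%:M ->
  ptrace2 ((1%:M *t A) *m X *m (1%:M *t B)) = ptrace2 X.
Proof.
move=> BA; rewrite !ptrace2_blk.
transitivity (\sum_g \sum_k (B *m A) k g *: blk (@sys_bath n) X g k).
  transitivity (\sum_f \sum_k \sum_g (B k f * A f g) *: blk (@sys_bath n) X g k).
    apply: eq_bigr => f _; rewrite blk_mul//; last exact: sys_bath_bij.
    apply: eq_bigr => k _; rewrite blk_sys_bath blk_mul; last exact: sys_bath_bij.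
    rewrite mulmx_suml; apply: eq_bigr => g _.
    by rewrite blk_sys_bath -scalemxAr mulmx1 -scalemxAl mul1mx scalerA.
  rewrite [RHS]exchange_big [LHS]exchange_big/=; apply: eq_bigr => k _.
  rewrite exchange_big/=; apply: eq_bigr => g _.
  by rewrite mxE scaler_suml.
rewrite BA; apply: eq_bigr => g _.
rewrite (bigD1 g)//= mxE eqxx scale1r big1 ?addr0// => k /negPf kg.
by rewrite mxE kg scale0r.
Qed.

Lemma LTO_local_dilation L : LTO beta H L ->
  exists (E : finType) (h : E -> R) W, (0 < #|E|)%N /\ local_dilation h W L.
Proof.
move=> [n [K [U [n0 Kh Uu UK LU]]]].
have [V [h [Vu KE]]] := hermitian_diagonalization Kh.
have VV : V *m V^t* = 1%:M by exact/unitarymxP.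
have VV' : V^t* *m V = 1%:M by exact: mulmx1C.
pose S : 'M[C]_(d * n) := 1%:M *t V.
have SE : S^t* = 1%:M *t V^t* by rewrite adjmx_tens adjmx1.
have SS : S *m S^t* = 1%:M by rewrite SE tensmx_mul mulmx1 VV tensmx11.
have SS' : S^t* *m S = 1%:M by exact: mulmx1C.
have Su : S \is unitarymx by exact/unitarymxP.
(* The unitary rewritten in the eigenbasis of the bath Hamiltonian, where that Hamiltonian and its
   Gibbs state are diagonal. *)
pose U' := S *m U *m S^t*.
have bij := sys_bath_bij n.
exists 'I_n, h, (blk (@sys_bath n) U'); split; first by rewrite card_ord.
split.
- exact: (blk_unitary bij (conj_unitarymx Su Uu)).
- have blkK f e : blk (@sys_bath n) (addtens H (diagC h)) f e =
      (H + (h e)%:C%C%:M) *+ (f == e).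
    rewrite /addtens -[LHS]/(blk _ _ f e).
    have -> : blk (@sys_bath n) (H *t 1%:M + 1%:M *t diagC h) f e =
        blk (@sys_bath n) (H *t 1%:M) f e + blk (@sys_bath n) (1%:M *t diagC h) f e.
      by apply/matrixP => i j; rewrite !mxE.
    rewrite !blk_sys_bath !mxE; case: eqVneq => [->|_].
      by rewrite !mulr1n scale1r scalemx1.
    by rewrite !mulr0n !scale0r addr0.
  apply/(comm_blk bij U' blkK).
  have -> : addtens H (diagC h) = S *m addtens H K *m S^t*.
    rewrite mulmxDr mulmxDl SE !tensmx_mul !mul1mx !mulmx1 VV KE !mulmxA VV mul1mx.
    by rewrite -mulmxA VV mulmx1.
  exact: conj_comm_mx.
- move=> rho; rewrite LU KE gibbs_conj_diagC//.
  rewrite -(blk_kraus bij U' (T := rho *t diagC (gibbs_weight beta h))) => [|f e].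
    have rhoE : S^t* *m (rho *t diagC (gibbs_weight beta h)) *m S =
        rho *t (V^t* *m diagC (gibbs_weight beta h) *m V).
      by rewrite SE !tensmx_mul mul1mx mulmx1.
    by rewrite -ptrace2_blk /U' conj_kraus rhoE SE (ptrace2_conj _ VV').
  rewrite blk_sys_bath !mxE.
  by case: eqVneq => [->|]; rewrite ?mulr1n ?mulr0n ?scale0r.
Qed.

End LocalDilation.

(** * Reassembling blocks into a semilocal unitary *)

Section BathIndices.
Variables (R : realType) (EA EB : finType) (d : nat).
Local Notation C := R[i].

Definition bath_index (e : EA * EB) : 'I_(#|EA| * #|EB|) :=
  mxtens_index (enum_rank e.1, enum_rank e.2).

Lemma bath_index_bij : bijective bath_index.
Proof.
exists (fun k => (enum_val (mxtens_unindex k).1, enum_val (mxtens_unindex k).2)).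
  by case=> a b; rewrite /bath_index mxtens_indexK /= !enum_rankK.
by move=> k; case: (mxtens_indexP k) => i j; rewrite /bath_index mxtens_indexK /= !enum_valK.
Qed.

Definition bath_sys (x : (EA * EB) * 'I_d) : 'I_((#|EA| * #|EB|) * d) :=
  mxtens_index (bath_index x.1, x.2).

Lemma bath_sys_bij : bijective bath_sys.
Proof.
have [g gK Kg] := bath_index_bij.
exists (fun k => (g (mxtens_unindex k).1, (mxtens_unindex k).2)).
  by case=> e i; rewrite /bath_sys mxtens_indexK /= gK.
by move=> k; case: (mxtens_indexP k) => i j; rewrite /bath_sys mxtens_indexK /= Kg.
Qed.

Lemma blk_bath_sys (K : 'M[C]_(#|EA| * #|EB|)) (X : 'M[C]_d) f e :
  blk bath_sys (K *t X) f e = K (bath_index f) (bath_index e) *: X.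
Proof. by apply/matrixP => i j; rewrite !mxE !mxtens_indexK. Qed.

Lemma ptrace1_blk (X : 'M[C]_((#|EA| * #|EB|) * d)) :
  ptrace1 X = \sum_f blk bath_sys X f f.
Proof.
apply/matrixP => i j; rewrite mxE summxE.
rewrite (reindex bath_index)/=; last exact/onW_bij/bath_index_bij.
by apply: eq_bigr => f _; rewrite mxE.
Qed.

Lemma diagC_enum (E : finType) (h : E -> R) (a b : E) :
  diagC (fun i : 'I_#|E| => h (enum_val i)) (enum_rank a) (enum_rank b) =
  (h b)%:C%C *+ (a == b).
Proof.
rewrite !mxE (can_eq enum_rankK) enum_rankK.
by case: eqVneq => [->|]; rewrite ?mulr1n ?mulr0n.
Qed.

Lemma blk_addtens_bath (hA : EA -> R) (hB : EB -> R) (G : 'M[C]_d) f e :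
  blk bath_sys (addtens (addtens (diagC (fun i : 'I_#|EA| => hA (enum_val i)))
      (diagC (fun i : 'I_#|EB| => hB (enum_val i)))) G) f e =
  (G + (hA e.1 + hB e.2)%:C%C%:M) *+ (f == e).
Proof.
have -> K : blk bath_sys (addtens K G) f e =
    blk bath_sys (K *t 1%:M) f e + blk bath_sys (1%:M *t G) f e.
  by apply/matrixP => i j; rewrite !mxE.
have oneE : (1%:M : 'M[C]_(#|EA| * #|EB|)) (bath_index f) (bath_index e) = (f == e)%:R.
  by rewrite mxE (bij_eq bath_index_bij).
rewrite !blk_bath_sys oneE.
have addE (K L : 'M[C]_(#|EA| * #|EB|)) : (K + L) (bath_index f) (bath_index e) =
  K (bath_index f) (bath_index e) + L (bath_index f) (bath_index e) by rewrite mxE.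
rewrite addE.
rewrite !tensmxE !diagC_enum !mxE !(can_eq enum_rankK).
move: f e {oneE addE} => [a b] [a' b']; rewrite xpair_eqE /=.
case: eqVneq => _; case: eqVneq => _; rewrite /= ?mulr1n ?mulr0n ?(mulr1, mul1r, mulr0, mul0r).
- by rewrite rmorphD scale1r addrC scalemx1.
- by rewrite addr0 !scale0r addr0.
- by rewrite addr0 !scale0r addr0.
- by rewrite addr0 !scale0r addr0.
Qed.

End BathIndices.

Lemma gibbs_weight_enum (R : realType) (E : finType) (beta : R) (h : E -> R) :
  gibbs_weight beta (fun i : 'I_#|E| => h (enum_val i)) =
  fun i => gibbs_weight beta h (enum_val i).
Proof.
apply/funext => i; rewrite /gibbs_weight; congr (_ / _).
rewrite [RHS](reindex (fun i : 'I_#|E| => enum_val i))//=.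
exact/onW_bij/enum_val_bij.
Qed.

Lemma gibbs_diagC (R : realType) n (beta : R) (h : 'I_n -> R) :
  gibbs beta (diagC h) = diagC (gibbs_weight beta h).
Proof.
have := @gibbs_conj_diagC R n beta 1%:M 1%:M h (mulmx1 _) (mulmx1 _).
by rewrite !mul1mx !mulmx1.
Qed.

Lemma diagC_hermsymmx (R : realType) n (h : 'I_n -> R) : diagC h \is hermsymmx.
Proof.
apply/hermsymmxP/matrixP => i j; rewrite !mxE eq_sym.
case: eqVneq => [->|_]; last by rewrite !mulr0n rmorph0.
by rewrite !mulr1n; apply: CrealP; apply/complex_realP; eexists.
Qed.

Lemma semilocal_SLTO (R : realType) (dA dB : nat) (betaA betaB : R)
    (HA : 'M[R[i]]_dA) (HB : 'M[R[i]]_dB) L :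
  semilocal betaA betaB (addtens HA HB)
    (addtens (betaA%:C%C *: HA) (betaB%:C%C *: HB)) L ->
  SLTO betaA betaB HA HB L.
Proof.
move=> [EA [EB [hA [hB [W [EA0 EB0 [Wi W1 W2 Wk]]]]]]].
have bij := bath_sys_bij EA EB (dA * dB).
have [U UW] := blk_surj bij W.
pose KA : 'M[R[i]]_#|EA| := diagC (fun i : 'I_#|EA| => hA (enum_val i)).
pose KB : 'M[R[i]]_#|EB| := diagC (fun i : 'I_#|EB| => hB (enum_val i)).
exists #|EA|, #|EB|, KA, KB, U; split.
- by split=> //; exact: diagC_hermsymmx.
- apply: (unitary_blk bij) => e e'; rewrite -Wi.
  by apply: eq_bigr => f _; rewrite !UW.
- apply/(comm_blk bij U (blk_addtens_bath hA hB (addtens HA HB))) => f e.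
  by rewrite UW; exact: W1.
(* The second law has the form of the first, with bath levels [betaA * hA] and [betaB * hB], so the
   same block criterion applies. *)
- have scaleK (beta : R) (E : finType) (h : E -> R) :
      beta%:C%C *: diagC (fun i : 'I_#|E| => h (enum_val i)) =
      diagC (fun i : 'I_#|E| => beta * h (enum_val i)).
    by apply/matrixP => i j; rewrite !mxE mulrnAr rmorphM.
  rewrite /KA /KB !scaleK.
  apply/(comm_blk bij U (blk_addtens_bath (fun a => betaA * hA a)
    (fun b => betaB * hB b) _)) => f e.
  by rewrite UW; exact: W2.
- move=> rho; rewrite Wk !gibbs_diagC ptrace1_blk.
  rewrite (blk_kraus bij U (rho := rho) (g := fun e =>
    (gibbs_weight betaA hA e.1 * gibbs_weight betaB hB e.2)%:C%C)) => [|f e].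
    by apply: eq_bigr => f _; apply: eq_bigr => e _; rewrite UW.
  rewrite blk_bath_sys tensmxE.
  rewrite !gibbs_weight_enum !diagC_enum; case: f e => [a b] [a' b']; rewrite xpair_eqE /=.
  case: eqVneq => _; case: eqVneq => _ //=;
    by rewrite ?mulr1n ?mulr0n ?mulr0 ?mul0r ?scale0r -?rmorphM.
Qed.

(** * One-way protocols *)

Section OneWay.
Variables (R : realType) (d : nat) (betaA betaB : R).
Local Notation C := R[i].
Variables (G1 G2 : 'M[C]_d) (m : nat) (P : 'I_m -> 'M[C]_d).
Variable Phi : 'I_m -> channel R d.
Hypothesis P_herm : forall k, (P k)^t* = P k.
Hypothesis P_idem : forall k, P k *m P k = P k.
Hypothesis P_orth : forall k l, k != l -> P k *m P l = 0.
Hypothesis P_sum : \sum_k P k = 1%:M.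
Hypothesis P_comm1 : forall k, comm_mx (P k) G1.
Hypothesis P_comm2 : forall k, comm_mx (P k) G2.
Hypothesis Phi_dilation : forall k,
  exists (EA EB : finType) (hA : EA -> R) (hB : EB -> R) W,
    [/\ (0 < #|EA|)%N, (0 < #|EB|)%N, dilation betaA betaB G1 G2 hA hB W (Phi k)
      & forall f e, comm_mx (P k) (W f e)].

(** The blocks of [Phi k] commute with [P k], so what is processed in range [k] stays there, out of
    reach of the other outcomes. *)
Lemma Phi_block k rho : Phi k (P k *m rho *m P k) = P k *m Phi k rho *m P k.
Proof.
have [EA [EB [hA [hB [W [_ _ [_ _ _ Wk] PW]]]]]] := Phi_dilation k.
rewrite !Wk mulmx_sumr mulmx_suml; apply: eq_bigr => f _.
rewrite mulmx_sumr mulmx_suml; apply: eq_bigr => e _.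
rewrite -scalemxAr -scalemxAl; congr (_ *: _).
have WP : (W f e)^t* *m P k = P k *m (W f e)^t*.
  by rewrite -{1}P_herm -adjmxM PW adjmxM P_herm.
by rewrite !mulmxA -PW -!mulmxA WP.
Qed.

(* Measuring the outcomes one at a time: after the steps of [s], the blocks in
   [s] have been processed and the rest of the state is left coherent. *)
Lemma semilocal_partial_measure (s : seq 'I_m) : uniq s ->
  let Q := 1%:M - \sum_(k <- s) P k in
  semilocal betaA betaB G1 G2 (fun rho =>
    \sum_(k <- s) Phi k (P k *m rho *m P k) + Q *m rho *m Q).
Proof.
elim: s => [_|k s IHs /= /andP[ks us]].
  apply: eq_semilocal (semilocal_id _ _ _ _) => rho /=.
  by rewrite !big_nil add0r subr0 mul1mx mulmx1.
have [EA [EB [hA [hB [W [EA0 EB0 WPhi PW]]]]]] := Phi_dilation k.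
have stepk := semilocal_measure EA0 EB0 WPhi (P_herm k) (P_idem k) (P_comm1 k)
  (P_comm2 k) PW.
apply: eq_semilocal (semilocal_comp stepk (IHs us)) => rho /=.
(* The outcomes in [s] have already contributed [S], orthogonal to [P k] on both sides; measuring
   [P k] therefore acts only on the coherent rest [Q *m rho *m Q], and shrinks [Q] to [Q - P k]. *)
set Q := 1%:M - \sum_(l <- s) P l; set S := \sum_(l <- s) Phi l _.
have PQ : P k *m Q = P k.
  rewrite mulmxBr mulmx1 mulmx_sumr big_seq big1 ?subr0// => l ls.
  by rewrite P_orth//; apply: contraNneq ks => ->.
have QP : Q *m P k = P k.
  rewrite mulmxBl mul1mx mulmx_suml big_seq big1 ?subr0// => l ls.
  by rewrite P_orth//; apply: contraNneq ks => <-.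
have PS : P k *m S = 0.
  rewrite mulmx_sumr big_seq big1// => l ls; rewrite Phi_block !mulmxA P_orth ?mul0mx//.
  by apply: contraNneq ks => ->.
have SP : S *m P k = 0.
  rewrite mulmx_suml big_seq big1// => l ls; rewrite Phi_block -mulmxA P_orth ?mulmx0//.
  by apply: contraNneq ks => <-.
have PtP : P k *m (S + Q *m rho *m Q) *m P k = P k *m rho *m P k.
  by rewrite mulmxDr PS add0r !mulmxA PQ -(mulmxA _ Q) QP.
have QtQ : (1%:M - P k) *m (S + Q *m rho *m Q) *m (1%:M - P k) =
    S + (Q - P k) *m rho *m (Q - P k).
  rewrite [_ *m (S + _)]mulmxDr [_ *m S]mulmxBl mul1mx PS subr0 mulmxDl.
  rewrite [S *m _]mulmxBr mulmx1 SP subr0; congr (_ + _).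
  have QL : (1%:M - P k) *m Q = Q - P k by rewrite mulmxBl mul1mx PQ.
  have QR : Q *m (1%:M - P k) = Q - P k by rewrite mulmxBr mulmx1 QP.
  by rewrite !mulmxA QL -(mulmxA _ Q) QR.
rewrite PtP QtQ !big_cons -/S addrA.
by rewrite (_ : 1%:M - _ = Q - P k)// opprD addrCA addrC.
Qed.

Lemma semilocal_one_way :
  semilocal betaA betaB G1 G2 (fun rho => \sum_k Phi k (P k *m rho *m P k)).
Proof.
apply: eq_semilocal (semilocal_partial_measure (index_enum_uniq _)) => rho.
by rewrite P_sum subrr !mul0mx addr0.
Qed.

End OneWay.

(** * Tensor products of channels *)

Section TensorChannel.
Variables (R : realType) (dA dB : nat).
Local Notation C := R[i].

Lemma matrix_tens_delta (X : 'M[C]_(dA * dB)) :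
  X = \sum_(i < dA) \sum_(j < dA) \sum_(k < dB) \sum_(l < dB)
    X (mxtens_index (i, k)) (mxtens_index (j, l)) *: (delta_mx i j *t delta_mx k l).
Proof.
rewrite {1}[X]matrix_sum_delta sum_mxtens_index; apply: eq_bigr => i _.
rewrite [RHS]exchange_big/=; apply: eq_bigr => k _.
rewrite sum_mxtens_index; apply: eq_bigr => j _; apply: eq_bigr => l _.
by rewrite tensmx_delta.
Qed.

(** Both sides are linear in [X] and agree on matrix units. The left and right families are
    independent so that Gibbs weights can be absorbed on one side, without square roots. *)
Lemma tens_channel_kraus (I J : finType) (A A' : I -> 'M[C]_dA) (B B' : J -> 'M[C]_dB)
    (L : channel R dA) (M : channel R dB) X :
  (forall rho, L rho = \sum_a A a *m rho *m A' a) ->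
  (forall rho, M rho = \sum_b B b *m rho *m B' b) ->
  tens_channel L M X = \sum_a \sum_b (A a *t B b) *m X *m (A' a *t B' b).
Proof.
move=> LA MB; rewrite /tens_channel.
pose T Y := \sum_a \sum_b (A a *t B b) *m Y *m (A' a *t B' b).
have Tsum n (Y : 'I_n -> 'M[C]_(dA * dB)) : T (\sum_i Y i) = \sum_i T (Y i).
  rewrite /T [RHS]exchange_big/=; apply: eq_bigr => a _.
  rewrite [RHS]exchange_big/=; apply: eq_bigr => b _.
  by rewrite mulmx_sumr mulmx_suml.
rewrite -/(T X) [X in T X]matrix_tens_delta.
rewrite Tsum; apply: eq_bigr => i _; rewrite Tsum; apply: eq_bigr => j _.
rewrite Tsum; apply: eq_bigr => k _; rewrite Tsum; apply: eq_bigr => l _.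
rewrite LA MB tensmx_suml scaler_sumr; apply: eq_bigr => a _.
rewrite tensmx_sumr scaler_sumr; apply: eq_bigr => b _.
by rewrite -scalemxAr -scalemxAl !tensmx_mul.
Qed.

End TensorChannel.

Section LocalLift.
Variables (R : realType) (dA dB : nat) (betaA betaB : R).
Local Notation C := R[i].
Variables (HA : 'M[C]_dA) (HB : 'M[C]_dB).

Lemma tens_channel_left (E : finType) h (W : E -> E -> 'M[C]_dA) L X :
  local_dilation betaA HA h W L ->
  tens_channel L (@id 'M[C]_dB) X = \sum_f \sum_e (gibbs_weight betaA h e)%:C%C *:
    ((W f e *t 1%:M) *m X *m (W f e *t 1%:M)^t*).
Proof.
move=> [_ _ Lk].
rewrite (@tens_channel_kraus _ _ _ (E * E)%type unit (fun z => W z.1 z.2)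
  (fun z => (gibbs_weight betaA h z.2)%:C%C *: (W z.1 z.2)^t*)
  (fun=> 1%:M) (fun=> 1%:M)) => [|rho|rho].
- rewrite [RHS]pair_bigA/=; apply: eq_bigr => z _; rewrite sum_unit adjmx_tens1.
  rewrite (scalemxAr _ _ (_ ^t* *t _)); congr (_ *m _).
  by apply/matrixP => x y; rewrite !mxE mulrA.
- rewrite Lk pair_bigA/=; apply: eq_bigr => z _.
  by rewrite scalemxAr.
- by rewrite sum_unit mul1mx mulmx1.
Qed.

Lemma tens_channel_right (E : finType) h (W : E -> E -> 'M[C]_dB) M X :
  local_dilation betaB HB h W M ->
  tens_channel (@id 'M[C]_dA) M X = \sum_f \sum_e (gibbs_weight betaB h e)%:C%C *:
    ((1%:M *t W f e) *m X *m (1%:M *t W f e)^t*).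
Proof.
move=> [_ _ Mk].
rewrite (@tens_channel_kraus _ _ _ unit (E * E)%type (fun=> 1%:M) (fun=> 1%:M)
  (fun z => W z.1 z.2) (fun z => (gibbs_weight betaB h z.2)%:C%C *: (W z.1 z.2)^t*))
  => [|rho|rho].
- rewrite sum_unit [RHS]pair_bigA/=; apply: eq_bigr => z _; rewrite adjmx_1tens.
  rewrite (scalemxAr _ _ (_ *t _ ^t*)); congr (_ *m _).
  by apply/matrixP => x y; rewrite !mxE mulrCA.
- by rewrite sum_unit mul1mx mulmx1.
- rewrite Mk pair_bigA/=; apply: eq_bigr => z _.
  by rewrite scalemxAr.
Qed.

Lemma comm_tens_left (X : 'M[C]_dA) (K : 'M[C]_dA) (H : 'M[C]_dB) :
  (X *t 1%:M) *m addtens K H - addtens K H *m (X *t 1%:M) =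
  (X *m K - K *m X) *t (1%:M : 'M[C]_dB).
Proof.
rewrite mulmxDr mulmxDl !tensmx_mul !mul1mx !mulmx1 opprD addrACA subrr addr0.
by apply/matrixP => x y; rewrite !mxE mulrBl.
Qed.

Lemma comm_tens_right (X : 'M[C]_dB) (K : 'M[C]_dA) (H : 'M[C]_dB) :
  (1%:M *t X) *m addtens K H - addtens K H *m (1%:M *t X) =
  (1%:M : 'M[C]_dA) *t (X *m H - H *m X).
Proof.
rewrite mulmxDr mulmxDl !tensmx_mul !mul1mx !mulmx1 opprD addrACA subrr add0r.
by apply/matrixP => x y; rewrite !mxE mulrBr.
Qed.

Lemma energy_shiftZ d (H : 'M[C]_d) (beta c : R) X :
  energy_shift H c X -> energy_shift (beta%:C%C *: H) (beta * c) X.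
Proof.
by rewrite /energy_shift -scalemxAr -scalemxAl -scalerBr rmorphM -scalerA => ->.
Qed.

Lemma energy_shift_left (K : 'M[C]_dA) (H : 'M[C]_dB) c X :
  energy_shift K c X -> energy_shift (addtens K H) c (X *t 1%:M).
Proof.
rewrite /energy_shift comm_tens_left => ->.
by apply/matrixP => x y; rewrite !mxE mulrA.
Qed.

Lemma energy_shift_right (K : 'M[C]_dA) (H : 'M[C]_dB) c X :
  energy_shift H c X -> energy_shift (addtens K H) c (1%:M *t X).
Proof.
rewrite /energy_shift comm_tens_right => ->.
by apply/matrixP => x y; rewrite !mxE mulrCA.
Qed.

Let G1 := addtens HA HB.
Let G2 := addtens (betaA%:C%C *: HA) (betaB%:C%C *: HB).

(** Bob's bath is trivial and only Alice's energy moves, so the second conservation law is [betaA]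
    times the first. *)
Lemma local_dilation_left (E : finType) (h : E -> R) W L :
  local_dilation betaA HA h W L ->
  dilation betaA betaB G1 G2 h (fun _ : unit => 0)
    (fun f e => W f.1 e.1 *t 1%:M) (tens_channel L (@id 'M[C]_dB)).
Proof.
move=> WL; have [Wi Ws _] := WL; split=> [[e []] [e' []]|f e|f e|rho].
- rewrite sum_pair_unit xpair_eqE eqxx andbT/=.
  under eq_bigr do rewrite adjmx_tens1 tensmx_mul mulmx1.
  rewrite -tensmx_suml Wi; case: eqVneq => _; rewrite ?mulr1n ?mulr0n ?tensmx11//.
  exact: tens0mx.
- by rewrite !addr0; exact: energy_shift_left.
- by rewrite mulr0 !addr0 -mulrBr; apply/energy_shift_left/energy_shiftZ.
- rewrite (tens_channel_left _ WL) sum_pair_unit; apply: eq_bigr => f _.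
  rewrite sum_pair_unit; apply: eq_bigr => e _.
  by rewrite gibbs_weight_unit mulr1.
Qed.

Lemma local_dilation_right (E : finType) (h : E -> R) W M :
  local_dilation betaB HB h W M ->
  dilation betaA betaB G1 G2 (fun _ : unit => 0) h
    (fun f e => 1%:M *t W f.2 e.2) (tens_channel (@id 'M[C]_dA) M).
Proof.
move=> WM; have [Wi Ws _] := WM; split=> [[[] e] [[] e']|f e|f e|rho].
- rewrite sum_unit_pair xpair_eqE eqxx/=.
  under eq_bigr do rewrite adjmx_1tens tensmx_mul mulmx1.
  rewrite -tensmx_sumr Wi; case: eqVneq => _; rewrite ?mulr1n ?mulr0n ?tensmx11//.
  exact: tensmx0.
- by rewrite !add0r; exact: energy_shift_right.
- by rewrite mulr0 !add0r -mulrBr; apply/energy_shift_right/energy_shiftZ.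
- rewrite (tens_channel_right _ WM) sum_unit_pair; apply: eq_bigr => f _.
  rewrite sum_unit_pair; apply: eq_bigr => e _.
  by rewrite gibbs_weight_unit mul1r.
Qed.

End LocalLift.

Section Factor.
Variables (R : realType) (dA dB : nat).
Local Notation C := R[i].

(** No positivity is encoded: the form only serves to give the linearity that splitting a tensor
    channel requires. *)
Definition has_kraus d (L : channel R d) : Prop :=
  exists (I : finType) (A A' : I -> 'M[C]_d),
    forall rho, L rho = \sum_a A a *m rho *m A' a.

Lemma LTO_has_kraus d beta (H : 'M[C]_d) L : LTO beta H L -> has_kraus L.
Proof.
move=> /LTO_local_dilation[E [h [W [_ [_ _ Lk]]]]].
exists (E * E)%type, (fun z => W z.1 z.2),
  (fun z => (gibbs_weight beta h z.2)%:C%C *: (W z.1 z.2)^t*) => rho.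
by rewrite Lk pair_bigA/=; apply: eq_bigr => z _; rewrite scalemxAr.
Qed.

Lemma tens_channel_sum m (L : channel R dA) (M : channel R dB) (X : 'I_m -> 'M[C]_(dA * dB)) :
  tens_channel L M (\sum_k X k) = \sum_k tens_channel L M (X k).
Proof.
do 4 (rewrite /tens_channel [RHS]exchange_big/=; apply: eq_bigr => ? _).
by rewrite summxE scaler_suml.
Qed.

Lemma id_kraus d (rho : 'M[C]_d) : id rho = \sum_(u : unit) 1%:M *m rho *m 1%:M.
Proof. by rewrite sum_unit mul1mx mulmx1. Qed.

Lemma tens_channel_left_right (L : channel R dA) (M : channel R dB) X :
  has_kraus L -> has_kraus M ->
  tens_channel L M X = tens_channel L id (tens_channel id M X).
Proof.
move=> [I [A [A' LA]]] [J [B [B' MB]]].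
rewrite (tens_channel_kraus X LA MB) (tens_channel_kraus _ LA (@id_kraus dB)).
rewrite (tens_channel_kraus X (@id_kraus dA) MB); apply: eq_bigr => a _.
rewrite !sum_unit mulmx_sumr mulmx_suml; apply: eq_bigr => b _.
by rewrite [A a *t B b](tensmx_split _ _).1 [A' a *t B' b](tensmx_split _ _).2 !mulmxA.
Qed.

Lemma tens_channel_right_left (L : channel R dA) (M : channel R dB) X :
  has_kraus L -> has_kraus M ->
  tens_channel L M X = tens_channel id M (tens_channel L id X).
Proof.
move=> [I [A [A' LA]]] [J [B [B' MB]]].
rewrite (tens_channel_kraus X LA MB) exchange_big/=.
rewrite (tens_channel_kraus _ (@id_kraus dA) MB).
rewrite (tens_channel_kraus X LA (@id_kraus dB)) sum_unit; apply: eq_bigr => b _.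
rewrite mulmx_sumr mulmx_suml; apply: eq_bigr => a _; rewrite sum_unit.
by rewrite [A a *t B b](tensmx_split _ _).2 [A' a *t B' b](tensmx_split _ _).1 !mulmxA.
Qed.

End Factor.

(** * Rounds of LTOCC *)

Section LTOCCSemilocal.
Variables (R : realType) (dA dB : nat) (betaA betaB : R).
Local Notation C := R[i].
Variables (HA : 'M[C]_dA) (HB : 'M[C]_dB).
Let G1 := addtens HA HB.
Let G2 := addtens (betaA%:C%C *: HA) (betaB%:C%C *: HB).

Lemma comm_mx_scale d (beta : R) (P H : 'M[C]_d) :
  comm_mx P H -> comm_mx P (beta%:C%C *: H).
Proof. by move=> PH; rewrite /comm_mx -scalemxAr -scalemxAl PH. Qed.

Lemma comm_mx_left (P K : 'M[C]_dA) (H : 'M[C]_dB) :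
  comm_mx P K -> comm_mx (P *t 1%:M) (addtens K H).
Proof.
by move=> PK; apply/subr0_eq; rewrite comm_tens_left PK subrr tens0mx.
Qed.

Lemma comm_mx_right (P H : 'M[C]_dB) (K : 'M[C]_dA) :
  comm_mx P H -> comm_mx (1%:M *t P) (addtens K H).
Proof.
by move=> PH; apply/subr0_eq; rewrite comm_tens_right PH subrr tensmx0.
Qed.

(** The round is split as [LA] after a measurement followed by [LB k] alone. The blocks [1%:M *t V]
    of the latter commute with [P k *t 1%:M], as the one-way argument demands; blocks of [LA] need
    not. *)
Lemma LTOCC1_from_Alice_semilocal L :
  LTOCC1_from_Alice betaA betaB HA HB L -> semilocal betaA betaB G1 G2 L.
Proof.
move=> [m [P [LA [LB [[Ph P0 P1 PH] LTOA LTOB Lk]]]]].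
have [E [h [W [E0 WA]]]] := LTO_local_dilation LTOA.
have semiA : semilocal betaA betaB G1 G2 (tens_channel LA (@id 'M[C]_dB)).
  exists E, unit, h, (fun=> 0), (fun f e => W f.1 e.1 *t 1%:M).
  by split; rewrite ?card_unit//; exact: local_dilation_left.
have semiB : semilocal betaA betaB G1 G2 (fun rho =>
    \sum_k tens_channel (@id 'M[C]_dA) (LB k) ((P k *t 1%:M) *m rho *m (P k *t 1%:M))).
  apply: (semilocal_one_way (P := fun k => P k *t 1%:M)
    (Phi := fun k => tens_channel id (LB k))) => [k|k|k l kl||k|k|k].
  - by rewrite adjmx_tens1; have [/hermsymmxP -> _] := Ph k.
  - by rewrite tensmx_mul mulmx1 (Ph k).2.
  - by rewrite tensmx_mul mulmx1 P0// tens0mx.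
  - by rewrite -tensmx_suml P1 tensmx11.
  - exact: comm_mx_left.
  - exact/comm_mx_left/comm_mx_scale.
  - have [F [g [V [F0 VB]]]] := LTO_local_dilation (LTOB k).
    exists unit, F, (fun=> 0), g, (fun f e => 1%:M *t V f.2 e.2).
    split=> //; first by rewrite card_unit.
      exact: local_dilation_right.
    by move=> f e; rewrite /comm_mx !tensmx_mul !mul1mx !mulmx1.
apply: eq_semilocal (semilocal_comp semiA semiB) => rho /=.
rewrite Lk tens_channel_sum; apply: eq_bigr => k _.
by rewrite -tens_channel_left_right//; apply: LTO_has_kraus; [exact: LTOA|exact: LTOB].
Qed.

Lemma LTOCC1_from_Bob_semilocal L :
  LTOCC1_from_Bob betaA betaB HA HB L -> semilocal betaA betaB G1 G2 L.
Proof.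
move=> [m [P [LA [LB [[Ph P0 P1 PH] LTOA LTOB Lk]]]]].
have [E [h [W [E0 WB]]]] := LTO_local_dilation LTOB.
have semiB : semilocal betaA betaB G1 G2 (tens_channel (@id 'M[C]_dA) LB).
  exists unit, E, (fun=> 0), h, (fun f e => 1%:M *t W f.2 e.2).
  by split; rewrite ?card_unit//; exact: local_dilation_right.
have semiA : semilocal betaA betaB G1 G2 (fun rho =>
    \sum_k tens_channel (LA k) (@id 'M[C]_dB) ((1%:M *t P k) *m rho *m (1%:M *t P k))).
  apply: (semilocal_one_way (P := fun k => 1%:M *t P k)
    (Phi := fun k => tens_channel (LA k) id)) => [k|k|k l kl||k|k|k].
  - by rewrite adjmx_1tens; have [/hermsymmxP -> _] := Ph k.
  - by rewrite tensmx_mul mulmx1 (Ph k).2.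
  - by rewrite tensmx_mul mulmx1 P0// tensmx0.
  - by rewrite -tensmx_sumr P1 tensmx11.
  - exact: comm_mx_right.
  - exact/comm_mx_right/comm_mx_scale.
  - have [F [g [V [F0 VA]]]] := LTO_local_dilation (LTOA k).
    exists F, unit, g, (fun=> 0), (fun f e => V f.1 e.1 *t 1%:M).
    split=> //; first by rewrite card_unit.
      exact: local_dilation_left.
    by move=> f e; rewrite /comm_mx !tensmx_mul !mul1mx !mulmx1.
apply: eq_semilocal (semilocal_comp semiB semiA) => rho /=.
rewrite Lk tens_channel_sum; apply: eq_bigr => k _.
by rewrite -tens_channel_right_left//; apply: LTO_has_kraus; [exact: LTOA|exact: LTOB].
Qed.

Lemma LTOCC_semilocal n L :
  LTOCC betaA betaB HA HB n L -> semilocal betaA betaB G1 G2 L.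
Proof.
elim: n L => [|n IHn] L /= => [Lid|[L1 [L2 [L1P /IHn L2P LE]]]].
  by apply: eq_semilocal (semilocal_id _ _ _ _) => rho; rewrite Lid.
apply: eq_semilocal (semilocal_comp _ L2P) => [rho|]; first by rewrite LE.
by case: L1P => [/LTOCC1_from_Alice_semilocal|/LTOCC1_from_Bob_semilocal].
Qed.

End LTOCCSemilocal.

Theorem theorem7 (R : realType) (dA dB : nat)
    (HA : 'M[R[i]]_dA) (HB : 'M[R[i]]_dB) (betaA betaB : R) (n : nat) :
  HA \is hermsymmx -> HB \is hermsymmx ->
  (betaA != 0) || (betaB != 0) ->
  (1 <= n)%N ->
  LTOCC_R betaA betaB HA HB n `<=` SLTO betaA betaB HA HB.
Proof.
move=> _ _ beta0 _ L [m [p [Ls [p0 p1 LsP LE]]]]; apply: semilocal_SLTO.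
have sp0 : 0 < \sum_i p i by rewrite p1 ltr01.
apply: eq_semilocal (semilocal_convex beta0 p0 sp0 (fun i => LTOCC_semilocal (LsP i))).
move=> rho; rewrite LE; apply: eq_bigr => i _.
by rewrite p1 divr1.
Qed.
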